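(* Let $n$ be an odd positive integer and let $N\in\mathbb{N}$ with $N<n$. There is no infinitely smooth convex body $K$ in $\mathbb{R}^n$ containing the origin in its interior such that for every even integer $m\ge N$ and every $\xi\in S^{n-1}$ we have $$A_{K,\xi}^{(m)}(0)=0.$$
   Context: A convex body in $\mathbb{R}^n$ is a compact convex set with non-empty interior. For a convex body $K$ containing the origin in its interior, its Minkowski functional is $\|x\|_K=\min\{a\ge 0: x\in aK\}$, $x\in\mathbb{R}^n$; $K$ is called infinitely smooth if $\|\cdot\|_K$ is a $C^\infty$-function on $\mathbb{R}^n\setminus\{0\}$. $K$ is not assumed to be origin-symmetric. For $\xi\in S^{n-1}$, the parallel section function of $K$ in the direction $\xi$ is $A_{K,\xi}(t)=\mathrm{vol}_{n-1}(K\cap\{x\in\mathbb{R}^n:(x,\xi)=t\})$, $t\in\mathbb{R}$, where $(\cdot,\cdot)$ is the scalar product in $\mathbb{R}^n$. If $K$ is infinitely smooth and contains the origin in its interior, $A_{K,\xi}$ is infinitely differentiable in a neighborhood of $t=0$ (uniform in $\xi$), and $A_{K,\xi}^{(m)}(0)$ denotes its derivative of order $m$ at $t=0$ (with $A_{K,\xi}^{(0)}=A_{K,\xi}$). *)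

(* Defs.v *)
From HB Require Import structures.
From mathcomp Require Export all_boot all_order all_algebra.
From mathcomp Require Export all_classical all_reals all_analysis.
Export numFieldNormedType.Exports.

Set Implicit Arguments.
Unset Strict Implicit.
Unset Printing Implicit Defensive.

Import Order.TTheory GRing.Theory Num.Theory.

Local Open Scope classical_set_scope.
Local Open Scope ring_scope.

(* The topology of 'rV[R]_n is that of the sup norm, hence the usual topology
   of R^n.  The Euclidean structure is carried by [dotv] alone. *)
Definition dotv (R : realType) (n : nat) (x y : 'rV[R]_n) : R :=
  \sum_(i < n) x 0 i * y 0 i.

Definition unit_sphere (R : realType) (n : nat) : set 'rV[R]_n :=
  [set xi | dotv xi xi = 1].
Arguments unit_sphere {R n}.

Definition convex_body (R : realType) (n : nat) (K : set 'rV[R]_n) : Prop :=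
  [/\ compact K, convex_set K & K° !=set0].

(* The infimum is a minimum as soon as K is a convex body with 0 in its
   interior. *)
Definition minkowski_functional (R : realType) (n : nat) (K : set 'rV[R]_n)
    (x : 'rV[R]_n) : R :=
  inf [set a : R | 0 <= a /\ [set a *: y | y in K] x].

(* All the iterated partial derivatives of f of order at most k exist and are
   continuous at every point of U (meant for U open). *)
Fixpoint continuously_diff (R : realType) (n k : nat) (U : set 'rV[R]_n)
    (f : 'rV[R]_n -> R) : Prop :=
  (forall x, U x -> {for x, continuous f}) /\
  match k with
  | 0%N => True
  | k'.+1 => forall i : 'I_n,
      (forall x, U x -> derivable f x (delta_mx 0 i)) /\
      continuously_diff k' U (fun x => 'D_(delta_mx 0 i) f x)
  end.

Definition infinitely_smooth (R : realType) (n : nat) (K : set 'rV[R]_n)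
    : Prop :=
  forall k, continuously_diff k [set x | x != 0] (minkowski_functional K).

(* k-fold product of the Lebesgue measure of R; in dimension 0 this is the
   unit mass at the only point. *)
Fixpoint lebesgue_tuple (R : realType) (k : nat) :
    set (k.-tuple (measurableTypeR R)) -> \bar R :=
  match k with
  | 0%N => fun A => dirac [tuple] A
  | k'.+1 => fun A =>
      (@lebesgue_measure R \x @lebesgue_tuple R k')%E
        [set p : measurableTypeR R * k'.-tuple (measurableTypeR R)
           | A [tuple of p.1 :: p.2]]
  end.

Definition lebesgue_rV (R : realType) (k : nat) (A : set 'rV[R]_k) : \bar R :=
  lebesgue_tuple [set t : k.-tuple (measurableTypeR R) | A (\row_i tnth t i)].

(* The rows of B form an orthonormal basis of the orthogonal complement of
   the unit vector xi. *)
Definition orthonormal_complement (R : realType) (n : nat) (xi : 'rV[R]_n) :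
    set 'M[R]_(n.-1, n) :=
  [set B | B *m B^T = 1%:M /\ B *m xi^T = 0].

(* (n-1)-dimensional volume of a subset S of a hyperplane orthogonal to the
   unit vector xi: the Lebesgue measure of S read in orthonormal coordinates
   x |-> x *m B^T, an isometry from such a hyperplane onto R^(n-1).  The value
   does not depend on the orthonormal basis B that [xget] selects. *)
Definition hyperplane_volume (R : realType) (n : nat) (xi : 'rV[R]_n)
    (S : set 'rV[R]_n) : \bar R :=
  lebesgue_rV
    [set x *m (xget 0 (orthonormal_complement xi))^T | x in S].

Definition parallel_section (R : realType) (n : nat) (K : set 'rV[R]_n)
    (xi : 'rV[R]_n) (t : R) : R :=
  fine (hyperplane_volume xi (K `&` [set x | dotv x xi = t])).

(* Main.v *)
(* Write n = 2h+1 with h > 0 (for n = 1, A_{K,xi}(0) = 1).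
   For a unit vector xi, the integral of A_{K,xi} over [-t, t] is the volume of
   the slab {x in K : |(x,xi)| <= t}.  In polar coordinates of the hyperplane,
   A_{K,xi}(t) is an average of powers of a radius which the implicit function
   theorem makes smooth in t near 0, with derivatives bounded uniformly in xi:
   by convexity the radial derivative of the Minkowski functional is bounded
   below at the boundary of K.  By Taylor, if A_{K,xi}^{(n-1)}(0) = 0 then the
   combination of the slab volumes at t, 2t, ..., 2^h t that annihilates t, t^3,
   ..., t^{n-2} is O(t^{n+1}).  Average it over xi in the shell 1 < |xi| <= 2 and
   exchange the integrals over xi and x.  Let the ball |x| <= eps lie in K.  The
   points |x| > eps contribute 0 for small t: by symmetry the average at x is, up
   to scaling, the combination of the slab volumes of the balls of radius 2 and 1,
   whose difference is an odd polynomial in t with no t^n term.  The points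
   |x| <= eps contribute a nonzero multiple of t^n: a contradiction. *)

(* The radii of the shell disappear because n = 2h+1 is odd: the section of the ball of radius r at
   height x is a multiple of (r^2 - x^2)^h, a polynomial in x whose top coefficient (-1)^h does not
   depend on r. So the t^n terms of the two balls bounding the shell cancel. Dilating by powers of 2
   makes the combination explicit: its coefficients are those of a polynomial q, and t^j is
   multiplied by q(2^j); it suffices to prescribe the roots of q. The shell stands in for the
   sphere, so that Lebesgue measure serves for every average over directions; homogeneity pays for
   the length of xi. The same device gives polar coordinates inside a hyperplane: there the radial
   measure dr/r over a dyadic range has a mass independent of the point. Most of the work is
   regularity. [derive1n] is a total function, so its vanishing says nothing before A_{K,xi} is
   known to be derivable, and since the Taylor remainder is integrated over xi, one bound has to
   serve all directions. The implicit function is therefore differentiated by hand, from an a priori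
   Lipschitz bound due to convexity and a lower bound on the radial derivative. *)
From HB Require Import structures.
Require Import Defs.
From mathcomp Require Import measurable_realfun ring lra.
Set Implicit Arguments.
Unset Strict Implicit.
Unset Printing Implicit Defensive.
Import Order.TTheory GRing.Theory Num.Theory.
Local Open Scope classical_set_scope.
Local Open Scope ring_scope.

(** * Lebesgue measure on row vectors, as a sigma-finite measure *)

Section measurable_row_vectors.
Context {R : realType} (k : nat).

Definition row_of_tuple (t : k.-tuple (measurableTypeR R)) : 'rV[R]_k :=
  \row_i tnth t i.

Definition tuple_of_row (x : 'rV[R]_k) : k.-tuple (measurableTypeR R) :=
  [tuple x 0 i | i < k].

Lemma row_of_tupleK : cancel row_of_tuple tuple_of_row.
Proof. by move=> t; apply: eq_from_tnth => i; rewrite tnth_mktuple mxE. Qed.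

Lemma tuple_of_rowK : cancel tuple_of_row row_of_tuple.
Proof. by move=> x; apply/rowP => i; rewrite mxE tnth_mktuple. Qed.

Let measurable_row (A : set 'rV[R]_k) := measurable (row_of_tuple @^-1` A).

Let measurable_row0 : measurable_row set0.
Proof. exact: measurable0. Qed.

Let measurable_rowC A : measurable_row A -> measurable_row (~` A).
Proof. exact: measurableC. Qed.

Let measurable_row_bigcup (F : (set 'rV[R]_k)^nat) :
  (forall i, measurable_row (F i)) -> measurable_row (\bigcup_i F i).
Proof. by move=> mF; rewrite /measurable_row preimage_bigcup; exact: bigcupT_measurable. Qed.

(* With these measurable sets, [lebesgue_rV] is the push-forward of
   [lebesgue_tuple] along a measurable isomorphism. *)
HB.instance Definition _ := @isMeasurable.Build default_measure_display
  'rV[R]_k measurable_row measurable_row0 measurable_rowC measurable_row_bigcup.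

Lemma measurable_row_of_tuple : measurable_fun setT row_of_tuple.
Proof. by move=> _ A mA; rewrite setTI. Qed.

Lemma measurable_tuple_of_row : measurable_fun setT tuple_of_row.
Proof.
move=> _ A mA; rewrite setTI /measurable/= /measurable_row -comp_preimage.
by rewrite (_ : _ \o _ = id) ?preimage_id//; apply/funext => t; exact: row_of_tupleK.
Qed.

End measurable_row_vectors.

(** Lets the product with the Lebesgue measure be iterated, each stage being again a legitimate
    factor for Fubini. Nondecreasing exhaustions are taken so that both coordinates can share one
    index. *)
Lemma sigma_finite_product d1 d2 (T1 : measurableType d1)
    (T2 : measurableType d2) (R : realType)
    (m1 : {sigma_finite_measure set T1 -> \bar R})
    (m2 : {sigma_finite_measure set T2 -> \bar R}) :
  sigma_finite setT (m1 \x m2)%E.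
Proof.
have /sigma_finiteP[F [FT ndF mF]] := sigma_finiteT m1.
have /sigma_finiteP[G [GT ndG mG]] := sigma_finiteT m2.
exists (fun n => F n `*` G n).
  apply/esym; rewrite -subTset => -[x y] _.
  have [i _ Fx] : (\bigcup_i F i) x by rewrite -FT.
  have [j _ Gy] : (\bigcup_i G i) y by rewrite -GT.
  exists (maxn i j) => //; split.
    by move: (x) Fx; apply/subsetPset/ndF/leq_maxl.
  by move: (y) Gy; apply/subsetPset/ndG/leq_maxr.
move=> i; have [mFi Fi] := mF i; have [mGi Gi] := mG i.
split; first exact: measurableX.
by rewrite product_measure1E// lte_mul_pinfty// ge0_fin_numE.
Qed.

Section image_sigma_finite_measure.
Local Open Scope ereal_scope.
Context d1 d2 (T1 : measurableType d1) (T2 : measurableType d2) (R : realType).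
Variables (mu : {measure set T1 -> \bar R}) (f : T1 -> T2) (g : T2 -> T1).
Hypotheses (smu : sigma_finite setT mu) (mf : measurable_fun setT f) (mg : measurable_fun setT g)
  (fK : cancel f g).

(** A push-forward whose term carries the four hypotheses, by dummy [let]s: the measure and
    sigma-finiteness instances below are then found from the term alone. *)
Definition image_measure : set T2 -> \bar R :=
  let _ := smu in let _ := mf in let _ := mg in let _ := fK in pushforward mu f.

Let image_measure0 : image_measure set0 = 0.
Proof. exact: measure0. Qed.

Let image_measure_ge0 A : 0 <= image_measure A.
Proof. exact: measure_ge0. Qed.

Let image_measure_sigma_additive : semi_sigma_additive image_measure.
Proof. exact: measure_semi_sigma_additive. Qed.

HB.instance Definition _ := isMeasure.Build _ _ _ image_measure
  image_measure0 image_measure_ge0 image_measure_sigma_additive.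

Let image_measure_sigma_finite : sigma_finite setT image_measure.
Proof.
have [F FT mF] := smu.
(* As [g] is a left inverse of [f], the [f]-preimage of these sets is [F i], of finite mass. *)
exists (fun i => g @^-1` F i); first by rewrite -preimage_bigcup -FT preimage_setT.
move=> i; have [mFi Fi] := mF i; split; first by rewrite -[X in measurable X]setTI; exact: mg.
rewrite /image_measure /pushforward -comp_preimage.
by rewrite (_ : g \o f = id) ?preimage_id//; exact/funext.
Qed.

HB.instance Definition _ := Measure_isSigmaFinite.Build _ _ _ image_measure
  image_measure_sigma_finite.

End image_sigma_finite_measure.

Section lebesgue_measure_on_rows.
Context {R : realType}.
Local Open Scope ereal_scope.

Definition tuple_cons k (p : measurableTypeR R * k.-tuple (measurableTypeR R)) :
  k.+1.-tuple (measurableTypeR R) := [tuple of p.1 :: p.2].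

Definition tuple_uncons k (t : k.+1.-tuple (measurableTypeR R)) :
  measurableTypeR R * k.-tuple (measurableTypeR R) :=
  (tnth t ord0, [tuple of behead t]).

Lemma measurable_tuple_cons k : measurable_fun setT (@tuple_cons k).
Proof. exact: measurable_cons. Qed.

Lemma measurable_tuple_uncons k : measurable_fun setT (@tuple_uncons k).
Proof.
apply: measurable_fun_pair; [exact: measurable_tnth|exact: measurable_behead].
Qed.

Lemma tuple_consK k : cancel (@tuple_cons k) (@tuple_uncons k).
Proof. by case=> s t; congr pair; exact: val_inj. Qed.

(** The recursion of [lebesgue_tuple], with the sigma-finite structure carried along at each
    stage. *)
Fixpoint lebesgue_tuple_measure k :
    {sigma_finite_measure set (k.-tuple (measurableTypeR R)) -> \bar R} :=
  match k with
  | 0%N => dirac ([tuple] : 0.-tuple (measurableTypeR R))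
  | k'.+1 => image_measure
      (sigma_finite_product lebesgue_measure (lebesgue_tuple_measure k'))
      (@measurable_tuple_cons k') (@measurable_tuple_uncons k') (@tuple_consK k')
  end.

Lemma lebesgue_tuple_measureE k :
  lebesgue_tuple_measure k = @lebesgue_tuple R k :> (set _ -> \bar R).
Proof. by elim: k => //= k <-. Qed.

Definition lebR k : {sigma_finite_measure set 'rV[R]_k -> \bar R} :=
  image_measure (sigma_finiteT (lebesgue_tuple_measure k)) (@measurable_row_of_tuple R k)
    (@measurable_tuple_of_row R k) (@row_of_tupleK R k).

Lemma lebRE k (A : set 'rV[R]_k) : lebesgue_rV A = lebR k A.
Proof. by rewrite /lebesgue_rV -lebesgue_tuple_measureE. Qed.

End lebesgue_measure_on_rows.

Lemma measurable_preimage d1 d2 (T1 : measurableType d1)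
    (T2 : measurableType d2) (f : T1 -> T2) (A : set T2) :
  measurable_fun setT f -> measurable A -> measurable (f @^-1` A).
Proof. by move=> mf mA; rewrite -[X in measurable X]setTI; exact: mf. Qed.

(** * Slicing along the first coordinate, and affine changes of variable *)

Section row_cons.
Context {R : realType}.

Lemma measurable_coord k (i : 'I_k) :
  measurable_fun setT (fun x : 'rV[R]_k => x 0 i : measurableTypeR R).
Proof.
have := measurableT_comp (@measurable_tnth _ (measurableTypeR R) k i)
  (@measurable_tuple_of_row R k).
by congr (measurable_fun _ _); apply/funext => x /=; rewrite tnth_mktuple.
Qed.

Lemma measurable_to_row d (T : measurableType d) k (f : T -> 'rV[R]_k) :
  (forall i, measurable_fun setT (fun x => f x 0 i : measurableTypeR R)) ->
  measurable_fun setT f.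
Proof.
move=> mf; rewrite (_ : f = @row_of_tuple R k \o (@tuple_of_row R k \o f)).
  apply: measurableT_comp; first exact: measurable_row_of_tuple.
  apply: (measurable_fun_tnthP _).2 => i.
  rewrite (_ : _ \o _ = fun x => f x 0 i)//.
  by apply/funext => x /=; rewrite tnth_mktuple.
by apply/funext => x /=; rewrite tuple_of_rowK.
Qed.

Lemma measurable_mulmx k m (M : 'M[R]_(k, m)) :
  measurable_fun setT (fun x : 'rV[R]_k => x *m M).
Proof.
apply: measurable_to_row => i; under [X in measurable_fun _ X]funext do rewrite mxE.
apply: measurable_sum => j; apply: measurable_funM => //; exact: measurable_coord.
Qed.

Lemma measurable_affine k (a : R) (b : 'rV[R]_k) :
  measurable_fun setT (fun x : 'rV[R]_k => a *: x + b).
Proof.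
apply: measurable_to_row => i; under [X in measurable_fun _ X]funext do rewrite !mxE.
by apply: measurable_funD => //; apply: measurable_funM => //; exact: measurable_coord.
Qed.

Lemma measurable_dotv k d (T : measurableType d) (f g : T -> 'rV[R]_k) :
  measurable_fun setT f -> measurable_fun setT g ->
  measurable_fun setT (fun x => dotv (f x) (g x)).
Proof.
move=> mf mg; apply: measurable_sum => i; apply: measurable_funM.
  exact: (measurableT_comp (measurable_coord i) mf).
exact: (measurableT_comp (measurable_coord i) mg).
Qed.

Definition row_cons k (s : R) (y : 'rV[R]_k) : 'rV[R]_k.+1 :=
  \row_i oapp (y 0) s (unlift ord0 i).

Lemma row_cons0 k (s : R) (y : 'rV[R]_k) : row_cons s y 0 ord0 = s.
Proof. by rewrite mxE unlift_none. Qed.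

Lemma row_consS k (s : R) (y : 'rV[R]_k) i : row_cons s y 0 (lift ord0 i) = y 0 i.
Proof. by rewrite mxE liftK. Qed.

Lemma row_cons_affine k (a s b : R) (y c : 'rV[R]_k) :
  a *: row_cons s y + row_cons b c = row_cons (a * s + b) (a *: y + c).
Proof.
apply/rowP => i; rewrite 2!mxE.
by case: (unliftP ord0 i) => [j|] ->; rewrite ?row_cons0 ?row_consS ?mxE.
Qed.

Lemma row_cons_eta k (x : 'rV[R]_k.+1) :
  x = row_cons (x 0 ord0) (\row_i x 0 (lift ord0 i)).
Proof.
apply/rowP => i.
by case: (unliftP ord0 i) => [j|] ->; rewrite ?row_cons0 ?row_consS ?mxE.
Qed.

Lemma measurable_row_cons k :
  measurable_fun setT (fun p : measurableTypeR R * 'rV[R]_k => row_cons p.1 p.2).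
Proof.
apply: measurable_to_row => i.
case: (unliftP ord0 i) => [j|] ->.
  under [X in measurable_fun _ X]funext do rewrite row_consS.
  exact: (measurableT_comp (measurable_coord j) measurable_snd).
under [X in measurable_fun _ X]funext do rewrite row_cons0.
exact: measurable_fst.
Qed.

Lemma measurable_row_cons_left k s :
  measurable_fun setT (fun y : 'rV[R]_k => row_cons s y).
Proof.
exact: (measurableT_comp (@measurable_row_cons k)
  (@pair1_measurable _ _ (measurableTypeR R) _ s)).
Qed.

Local Open Scope ereal_scope.

(** Holds for every [A], because the product measure is by definition the integral of the measures
    of the sections. *)
Lemma lebR_cons k (A : set 'rV[R]_k.+1) :
  lebR k.+1 A = \int[lebesgue_measure]_s lebR k [set y | A (row_cons s y)].
Proof.
apply: eq_integral => s _; congr (lebesgue_tuple_measure k _).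
apply/funext => t; rewrite /xsection/=; apply/propext; rewrite inE/=.
suff -> : row_of_tuple (tuple_cons (s, t)) = row_cons s (row_of_tuple t) by [].
apply/rowP => i; case: (unliftP ord0 i) => [j|] ->.
  by rewrite row_consS !mxE/= tnthS.
by rewrite row_cons0 !mxE tnth0.
Qed.

Lemma measurable_lebR_section k (A : set 'rV[R]_k.+1) : measurable A ->
  measurable_fun setT
    (fun s : measurableTypeR R => lebR k [set y | A (row_cons s y)]).
Proof.
move=> mA; rewrite (_ : (fun s => _) = lebR k \o xsection
  ((fun p : measurableTypeR R * 'rV[R]_k => row_cons p.1 p.2) @^-1` A)).
  apply: measurable_fun_xsection; apply: measurable_preimage => //.
  exact: measurable_row_cons.
apply/funext => s /=; congr (lebR k _).
by apply/funext => y; rewrite /xsection/=; apply/propext; rewrite inE/=.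
Qed.

Lemma lebR0 (A : set 'rV[R]_0) : lebR 0 A = dirac (0%R : 'rV[R]_0) A.
Proof.
rewrite [LHS](_ : _ = dirac ([tuple] : 0.-tuple (measurableTypeR R)) (@row_of_tuple R 0 @^-1` A))//.
rewrite !diracE; congr (_%:R%:E); congr nat_of_bool; apply/idP/idP; rewrite !inE/=.
  by rewrite (_ : row_of_tuple _ = 0%R)//; apply/rowP; case.
by rewrite (_ : row_of_tuple _ = 0%R)//; apply/rowP; case.
Qed.

(** The scaled push-forward agrees with the Lebesgue measure on half-open intervals, which determine
    it. *)
Lemma lebesgue_measure_affine (a b : R) (A : set (measurableTypeR R)) : (0 < a)%R ->
  measurable A ->
  a%:E * lebesgue_measure ((fun s => a * s + b)%R @^-1` A) = lebesgue_measure A.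
Proof.
move=> a0 mA.
have mf : measurable_fun setT ((fun s => a * s + b)%R : measurableTypeR R -> measurableTypeR R).
  by apply: measurable_funD => //; exact: mulrl_measurable.
pose m := mscale (NngNum (ltW a0)) (pushforward lebesgue_measure
  ((fun s => a * s + b)%R : measurableTypeR R -> measurableTypeR R)).
rewrite [RHS](@lebesgue_measure_unique _ (m mf))// => _ [[u v]] _ <-.
rewrite /m /= /mscale/= /pushforward (_ : _ @^-1` _ =
    `]((u - b) / a)%R, ((v - b) / a)%R]%classic); last first.
  apply/seteqP; split=> s /=; rewrite !in_itv/=.
    by rewrite ltr_pdivrMr// ler_pdivlMr// ltrBlDr lerBrDr mulrC.
  by rewrite ltr_pdivrMr// ler_pdivlMr// ltrBlDr lerBrDr mulrC.
rewrite !lebesgue_measure_itv/= !lte_fin ltr_pM2r ?invr_gt0// ltrD2r.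
case: ifP => _; last by rewrite mule0.
by rewrite -!EFinB -EFinM; congr EFin; field; rewrite gt_eqF.
Qed.

Lemma ge0_integral_affine (a b : R) (f : R -> \bar R) : (0 < a)%R ->
  measurable_fun setT f -> (forall s, 0 <= f s) ->
  a%:E * \int[lebesgue_measure]_s f (a * s + b)%R = \int[lebesgue_measure]_s f s.
Proof.
move=> a0 mf f0.
have mh : measurable_fun setT ((fun s => a * s + b)%R : measurableTypeR R -> measurableTypeR R).
  by apply: measurable_funD => //; exact: mulrl_measurable.
pose m := mscale (NngNum (ltW a0)) (pushforward lebesgue_measure
  ((fun s => a * s + b)%R : measurableTypeR R -> measurableTypeR R)).
transitivity (\int[m mh]_s f s).
  rewrite ge0_integral_mscale//; congr (_ * _).
  by rewrite ge0_integral_pushforward.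
apply: eq_measure_integral => A mA _.
exact: lebesgue_measure_affine.
Qed.

Lemma lebR_affine k (a : R) (b : 'rV[R]_k) (A : set 'rV[R]_k) : (0 < a)%R ->
  measurable A ->
  (a ^+ k)%:E * lebR k [set x | A (a *: x + b)%R] = lebR k A.
Proof.
move=> a0; elim: k b A => [|k IHk] b A mA.
  rewrite expr0 mul1e; congr (lebR 0 _); apply/funext => x.
  by congr A; apply/rowP; case.
rewrite !lebR_cons -[RHS](@ge0_integral_affine a (b 0%R ord0))//; last first.
  exact: measurable_lebR_section.
rewrite exprS EFinM -muleA; congr (_ * _).
rewrite -ge0_integralZl//; last 2 first.
  apply: (@measurable_lebR_section k [set x | A (a *: x + b)%R]).
  exact: measurable_preimage (measurable_affine a b) mA.
  by rewrite lee_fin exprn_ge0// ltW.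
apply: eq_integral => s _.
rewrite -[RHS](IHk (\row_i b 0%R (lift ord0 i))); last first.
  exact: measurable_preimage (measurable_row_cons_left _) mA.
congr (_ * lebR k _); apply/funext => y /=.
by rewrite {1}(row_cons_eta b) row_cons_affine.
Qed.

End row_cons.

(** * The Euclidean scalar product *)

Section dotv_theory.
Context {R : realType} {k : nat}.
Implicit Types x y z : 'rV[R]_k.

Lemma dotvE x y : dotv x y = (x *m y^T) 0 0.
Proof. by rewrite mxE; apply: eq_bigr => i _; rewrite mxE. Qed.

Lemma dotvC x y : dotv x y = dotv y x.
Proof. by apply: eq_bigr => i _; rewrite mulrC. Qed.

Lemma dotvDl x y z : dotv (x + y) z = dotv x z + dotv y z.
Proof. by rewrite /dotv -big_split; apply: eq_bigr => i _; rewrite mxE mulrDl. Qed.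

Lemma dotvZl (a : R) x z : dotv (a *: x) z = a * dotv x z.
Proof. by rewrite /dotv big_distrr/=; apply: eq_bigr => i _; rewrite mxE mulrA. Qed.

Lemma dotvDr x y z : dotv x (y + z) = dotv x y + dotv x z.
Proof. by rewrite dotvC dotvDl !(dotvC x). Qed.

Lemma dotvZr (a : R) x z : dotv x (a *: z) = a * dotv x z.
Proof. by rewrite dotvC dotvZl dotvC. Qed.

Lemma dotv_ge0 x : 0 <= dotv x x.
Proof. by apply: sumr_ge0 => i _; rewrite -expr2 sqr_ge0. Qed.

Lemma coord_sqr_le_dotv x i : x 0 i ^+ 2 <= dotv x x.
Proof.
rewrite /dotv (bigD1 i)//= -expr2 lerDl; apply: sumr_ge0 => j _.
by rewrite -expr2 sqr_ge0.
Qed.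

Lemma dotv_eq0 x : (dotv x x == 0) = (x == 0).
Proof.
apply/eqP/eqP => [x0|->]; last by apply: big1 => i _; rewrite mxE mul0r.
apply/rowP => i; rewrite mxE; apply/eqP; rewrite -(@sqrf_eq0 R).
by rewrite eq_le sqr_ge0 andbT -x0 coord_sqr_le_dotv.
Qed.

Lemma dotv_gt0 x : (0 < dotv x x) = (x != 0).
Proof. by rewrite lt_def dotv_eq0 dotv_ge0 andbT. Qed.

End dotv_theory.

Lemma dotv_mulmxr {R : realType} k m (x : 'rV[R]_k) (M : 'M[R]_(k, m)) (y : 'rV[R]_m) :
  dotv (x *m M) y = dotv x (y *m M^T).
Proof. by rewrite !dotvE trmx_mul trmxK mulmxA. Qed.

Lemma dotv_mulmx_orth {R : realType} k m (x y : 'rV[R]_k) (M : 'M[R]_(k, m)) :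
  M *m M^T = 1%:M -> dotv (x *m M) (y *m M) = dotv x y.
Proof. by move=> MM; rewrite dotv_mulmxr -mulmxA MM mulmx1. Qed.

(** * Open sets, balls, and invariance of Lebesgue measure under orthogonal matrices *)

Section orthogonal_invariance.
Context {R : realType}.

Lemma measurable_le_fun d (T : measurableType d) (f : T -> R) (c : R) :
  measurable_fun setT f -> measurable [set x | f x <= c].
Proof.
move=> mf; rewrite (_ : mkset _ = f @^-1` [set` `]-oo, c]]).
  exact: measurable_preimage.
by apply/seteqP; split => x /=; rewrite in_itv/=.
Qed.

Lemma measurable_ge_fun d (T : measurableType d) (f : T -> R) (c : R) :
  measurable_fun setT f -> measurable [set x | c <= f x].
Proof.
move=> mf; rewrite (_ : mkset _ = f @^-1` [set` `[c, +oo[]).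
  exact: measurable_preimage.
by apply/seteqP; split => x /=; rewrite in_itv/= andbT.
Qed.

(** The measurable sets are those of the product sigma-algebra, so an open set has to be written as
    a countable union: the cubes [B p] with rational centre and radius 1/(j+1) that it contains. *)
Lemma open_measurable_row k (U : set 'rV[R]_k) : open U -> measurable U.
Proof.
move=> oU.
pose B (p : 'rV[rat]_k * nat) := [set y : 'rV[R]_k |
  forall i, ball (ratr (p.1 0 i) : R) p.2.+1%:R^-1 (y 0 i)].
have mB p : measurable (B p).
  rewrite (_ : B p = \bigcap_(i in [set: 'I_k]) ((fun y : 'rV[R]_k => y 0 i)
      @^-1` ball (ratr (p.1 0 i) : R) p.2.+1%:R^-1)).
    apply: fin_bigcap_measurable => // i _.
    by apply: measurable_preimage; [exact: measurable_coord|exact: measurable_ball].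
  by apply/seteqP; split => y /= H i; [move=> _|]; exact: H.
rewrite (_ : U = \bigcup_(p in [set p | B p `<=` U]) B p); last first.
  apply/seteqP; split => [y Uy|y [p]]; last exact.
  have /nbhs_ballP[e /= e0 yeU] : nbhs y U by exact: open_nbhs_nbhs.
  (* Two radii: one from [y] to the rational centre, one from the centre to any point of the
     cube. *)
  have [j] : exists j, j.+1%:R^-1 + j.+1%:R^-1 < e.
    have e20 : 0 < e / 2 by rewrite divr_gt0.
    have [j /= je] : exists j, j.+1%:R^-1 < e / 2.
      by near \oo => j; exists j; near: j; exact: near_infty_natSinv_lt (PosNum e20).
    by exists j; rewrite (splitr e) ltrD.
  move=> je.
  have /choice[q qP] : forall i, exists q : rat, ball (y 0 i : R) j.+1%:R^-1 (ratr q).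
    move=> i; have [|q] := @rat_in_itvoo R (y 0 i - j.+1%:R^-1) (y 0 i + j.+1%:R^-1).
      by rewrite ltrD2l gtrN// invr_gt0.
    rewrite in_itv/= => /andP[q1 q2]; exists q.
    by rewrite -ball_normE/= ltr_distlC q1.
  exists (\row_i q i, j) => /=; last by move=> i; rewrite mxE; exact: ball_sym.
  move=> z zB; apply: yeU; split => // a i; rewrite (ord1 a).
  apply: le_ball (ltW je) _ _; apply: ball_triangle (qP i) _.
  by have := zB i; rewrite mxE.
rewrite bigcup_mkcond; apply: countable_bigcupT_measurable => // p.
by case: ifP.
Unshelve. all: by end_near. Qed.

Lemma closed_measurable_row k (A : set 'rV[R]_k) : closed A -> measurable A.
Proof.
move=> cA; rewrite -(setCK A); apply: measurableC; apply: open_measurable_row.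
exact: closed_openC.
Qed.

(** Euclidean, unlike [ball], which is a cube for the sup norm of rows. *)
Definition ball2 k (r : R) : set 'rV[R]_k := [set x | dotv x x <= r ^+ 2].
Arguments ball2 k r : clear implicits.

Lemma measurable_ball2 k r : measurable (ball2 k r).
Proof.
exact: (measurable_le_fun _
  (measurable_dotv (@measurable_id _ _ setT) (@measurable_id _ _ setT))).
Qed.

Local Open Scope ereal_scope.

Lemma lebR_cube k (r : R) : (0 <= r)%R ->
  lebR k [set x | forall i, x 0%R i \in `[0%R, r]] = (r ^+ k)%:E.
Proof.
move=> r0; elim: k => [|k IHk].
  by rewrite lebR0 diracE mem_set// => -[].
rewrite lebR_cons (eq_integral (fun s : measurableTypeR R => (r ^+ k)%:E * (\1_(`[0%R, r]) s)%:E)).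
  rewrite ge0_integralZl//=; last by rewrite lee_fin exprn_ge0.
    rewrite integral_indic// setIT.
    rewrite -[X in _ * X]/(lebesgue_measure `[0%R, r]%classic) lebesgue_measure_itv/= lte_fin.
    have [_|] := ltP 0%R r; first by rewrite sube0 -EFinM exprSr.
    move=> rle0; rewrite mule0 exprS (_ : r = 0%R) ?mul0r//.
    by apply/eqP; rewrite eq_le rle0.
  by apply/measurable_EFinP; exact: measurable_indic.
move=> s _; rewrite indicE; have [sr|sr] := boolP (s \in _).
  rewrite mule1 -IHk; congr (lebR k _); apply/seteqP; split=> y /= H i.
    by rewrite -(row_consS s y i).
  case: (unliftP ord0 i) => [j|] ->; rewrite ?row_cons0 ?row_consS//.
  by rewrite inE in sr.
rewrite mule0 (_ : [set y | _] = set0) ?measure0//.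
apply/seteqP; split => // y /= /(_ ord0); rewrite row_cons0 => H.
by move/negP: sr; apply; exact: mem_set.
Qed.

Lemma measurable_cube k (r : R) :
  measurable [set x : 'rV[R]_k | forall i, x 0%R i \in `[0%R, r]].
Proof.
rewrite (_ : [set x | _] = \bigcap_(i in [set: 'I_k])
  ((fun x : 'rV[R]_k => x 0%R i) @^-1` `[0%R, r]%classic)).
  apply: fin_bigcap_measurable => // i _.
  by apply: measurable_preimage; first exact: measurable_coord.
by apply/seteqP; split => y /= H i; [move=> _|]; exact: H.
Qed.

Lemma lebR_ball2_lty k (r : R) : lebR k (ball2 k r) < +oo.
Proof.
(* The ball lies in the cube [-M, M]^k, which a translation moves to the cube [0, 2M]^k of known
   volume. *)
set M := (`|r| + 1)%R; have M0 : (0 < M)%R by rewrite /M ltr_wpDl.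
have le1 : lebR k [set x | forall i, (1%R *: x + const_mx M)%R 0%R i \in `[0%R, (M + M)%R]] < +oo.
  rewrite -[X in X < _]mul1e -[X in X%:E * _](expr1n R k).
  rewrite (@lebR_affine _ _ 1 (const_mx M)
    [set x | forall i, x 0%R i \in `[0%R, (M + M)%R]]) ?ltr01//.
    by rewrite lebR_cube ?ltry// addr_ge0// ltW.
  exact: measurable_cube.
apply: le_lt_trans le1; apply: le_measure; rewrite ?inE//.
- exact: measurable_ball2.
- exact: (measurable_preimage (measurable_affine 1 (const_mx M)) (@measurable_cube k (M + M)%R)).
move=> x /= xr i; rewrite scale1r !mxE in_itv/=.
have : (x 0 i ^+ 2 <= M ^+ 2)%R.
  apply: le_trans (coord_sqr_le_dotv _ _) (le_trans xr _).
  by rewrite -[leLHS]real_normK ?num_real// lerXn2r ?nnegrE// ?lerDl// ltW.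
rewrite -[X in (X <= _)%R]real_normK ?num_real// ler_pXn2r ?nnegrE ?(ltW M0)// ler_norml.
by move=> /andP[? ?]; apply/andP; split; lra.
Qed.

Lemma lebR_ball2_gt0 k (r : R) : (0 < r)%R -> 0 < lebR k (ball2 k r).
Proof.
(* Chosen so that k c^2 <= r^2, which puts the cube [0, c]^k inside the ball. *)
move=> r0; set c := (r / k.+1%:R)%R.
have c0 : (0 < c)%R by rewrite divr_gt0.
apply: (@lt_le_trans _ _ (lebR k [set x | forall i, x 0%R i \in `[0%R, c]])).
  by rewrite lebR_cube ?ltW// lte_fin exprn_gt0.
apply: le_measure; rewrite ?inE; [exact: measurable_cube|exact: measurable_ball2|].
move=> x /= xc; rewrite /ball2/= /dotv (@le_trans _ _ (\sum_(i < k) c ^+ 2)%R)//.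
  apply: ler_sum => i _; have := xc i; rewrite in_itv/= => /andP[? ?].
  by rewrite -expr2 lerXn2r ?nnegrE// ltW.
rewrite sumr_const card_ord /c expr_div_n -mulrnAr ler_piMr ?sqr_ge0//.
rewrite -[X in (X *+ _)%R]mul1r -mulrnAl ler_pdivrMr ?exprn_gt0// mul1r -natrX ler_nat.
by rewrite expnS expn1 (leq_trans (leqnSn k))// leq_pmulr.
Qed.

(** The substitute for the unit sphere, both for the directions [xi] and for polar directions inside
    a hyperplane: it has positive dimension-independent thickness and finite Lebesgue measure. *)
Definition shell k : set 'rV[R]_k := ball2 k 2 `\` ball2 k 1.
Arguments shell k : clear implicits.

Lemma measurable_shell k : measurable (shell k).
Proof. by apply: measurableD; exact: measurable_ball2. Qed.

Lemma lebR_shell_lty k : lebR k (shell k) < +oo.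
Proof.
apply: le_lt_trans (@lebR_ball2_lty k 2); apply: le_measure; rewrite ?inE.
- exact: measurable_shell.
- exact: measurable_ball2.
- exact: subIsetl.
Qed.

Lemma lebR_shift k (b : 'rV[R]_k) (A : set 'rV[R]_k) : measurable A ->
  lebR k [set x | A (x + b)%R] = lebR k A.
Proof.
move=> mA; rewrite -[RHS](lebR_affine b ltr01)// expr1n mul1e.
by congr (lebR k _); apply/funext => x /=; rewrite scale1r.
Qed.

(* Haar uniqueness by double counting: for a translation invariant measure nu
   and a symmetric set D, computing the product measure of
   {(x, y) | x \in D, x + y \in B} in both orders gives
   mu D * nu B = mu B * nu D. *)
Lemma translation_invariant_double_counting k
    (nu : {sigma_finite_measure set 'rV[R]_k -> \bar R}) (D B : set 'rV[R]_k) :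
  (forall (b : 'rV[R]_k) (A : set 'rV[R]_k), measurable A -> nu [set x | A (x + b)%R] = nu A) ->
  measurable D -> measurable B -> (forall x, D (- x)%R -> D x) ->
  lebR k D * nu B = lebR k B * nu D.
Proof.
move=> nu_shift mD mB Dsym.
pose S := [set p : 'rV[R]_k * 'rV[R]_k | D p.1 /\ B (p.1 + p.2)%R].
have madd : measurable_fun setT (fun p : 'rV[R]_k * 'rV[R]_k => (p.1 + p.2)%R).
  apply: measurable_to_row => i; under [X in measurable_fun _ X]funext do rewrite mxE.
  apply: measurable_funD; first exact: (measurableT_comp (measurable_coord i) measurable_fst).
  exact: (measurableT_comp (measurable_coord i) measurable_snd).
have mS : measurable S.
  apply: measurableI; first exact: (measurable_preimage measurable_fst mD).
  exact: (measurable_preimage madd mB).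
have int_indic (mu : {sigma_finite_measure set 'rV[R]_k -> \bar R}) (A E : set 'rV[R]_k)
    (c : \bar R) : measurable A -> 0 <= c ->
    \int[mu]_x ((\1_A x)%:E * c) = mu A * c.
  move=> mA c0; rewrite ge0_integralZr//; last exact/measurable_EFinP/measurable_indic.
  by rewrite integral_indic// setIT.
have SE : (lebR k \x nu) S = (lebR k \x^ nu) S.
  apply: product_measure_unique => // A1 A2 mA1 mA2.
  exact: product_measure2E.
transitivity ((lebR k \x nu) S).
  rewrite /product_measure1 -int_indic//; apply: eq_integral => x _ /=.
  rewrite indicE; have [xD|xD] := boolP (x \in D).
    rewrite mul1e -(nu_shift x)//; congr (nu _); apply/funext => y.
    rewrite /xsection/=; apply/propext; rewrite inE/= addrC; split=> [?|[]//].
    by split => //; rewrite inE in xD.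
  rewrite mul0e (_ : xsection _ _ = set0) ?measure0//.
  rewrite /xsection; apply/seteqP; split => // y /=; rewrite inE => -[/= Dx _].
  by rewrite mem_set in xD.
rewrite SE.
(* For fixed y, shifting the first variable by y turns [S] into [S'] without changing its Lebesgue
   measure; the other sections of [S'] are translates of [D], up to the symmetry of [D]. *)
pose S' := [set p : 'rV[R]_k * 'rV[R]_k | D (p.1 - p.2)%R /\ B p.1].
have mS' : measurable S'.
  have msub : measurable_fun setT (fun p : 'rV[R]_k * 'rV[R]_k => (p.1 - p.2)%R).
    apply: measurable_to_row => i; under [X in measurable_fun _ X]funext do rewrite !mxE.
    apply: measurable_funB; first exact: (measurableT_comp (measurable_coord i) measurable_fst).
    exact: (measurableT_comp (measurable_coord i) measurable_snd).
  apply: measurableI; first exact: (measurable_preimage msub mD).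
  exact: (measurable_preimage measurable_fst mB).
have SE' : (lebR k \x nu) S' = (lebR k \x^ nu) S'.
  apply: product_measure_unique => // A1 A2 mA1 mA2.
  exact: product_measure2E.
transitivity ((lebR k \x^ nu) S').
  apply: eq_integral => y _.
  transitivity (lebR k [set x | ysection S' y (x + y)%R]); last first.
    by apply: lebR_shift; exact: measurable_ysection.
  congr (lebR k _); apply/funext => x; rewrite /ysection/=; apply/propext.
  by rewrite !inE /S/S'/= addrK.
rewrite -SE' /product_measure1 -int_indic//; apply: eq_integral => x _ /=.
rewrite indicE; have [xB|xB] := boolP (x \in B).
  rewrite mul1e -(nu_shift (- x)%R D)//; congr (nu _); apply/funext => y.
  rewrite /xsection/=; apply/propext; rewrite inE/=; split=> [[Dxy _]|Dyx].
    by apply: Dsym; rewrite opprB.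
  by split; [apply: Dsym; rewrite opprB|rewrite inE in xB].
rewrite mul0e (_ : xsection _ _ = set0) ?measure0//.
rewrite /xsection; apply/seteqP; split => // y /=; rewrite inE => -[/= _ Bx].
by rewrite mem_set in xB.
Qed.

Lemma pmule_inj (d a b : \bar R) : d \is a fin_num -> 0 < d ->
  a * d = b * d -> a = b.
Proof.
move=> dfin d0 abd; apply/eqP; rewrite eq_le.
by rewrite -(lee_pmul2r dfin d0) abd lexx -(lee_pmul2r dfin d0) abd lexx.
Qed.

(** The image [nu] of Lebesgue measure under [M] is translation invariant, and it gives the unit
    ball its usual measure because [M] preserves the ball. Double counting with [D] the unit ball,
    of finite positive measure, then identifies [nu] with Lebesgue measure. *)
Lemma lebR_orth k (M : 'M[R]_k) (A : set 'rV[R]_k) : M *m M^T = 1%:M ->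
  measurable A -> lebR k [set x | A (x *m M)] = lebR k A.
Proof.
move=> MM mA.
have MK : cancel (fun x : 'rV[R]_k => x *m M) (fun x => x *m M^T).
  by move=> x; rewrite -mulmxA MM mulmx1.
have MK' (x : 'rV[R]_k) : x *m M^T *m M = x by rewrite -mulmxA (mulmx1C MM) mulmx1.
pose nu := image_measure (sigma_finiteT (lebR k)) (measurable_mulmx M)
  (measurable_mulmx M^T) MK.
have nuE B : nu B = lebR k [set x | B (x *m M)] by [].
have nuD : nu (ball2 k 1) = lebR k (ball2 k 1).
  rewrite nuE; congr (lebR k _); apply/funext => x.
  by rewrite /ball2/= dotv_mulmx_orth.
have D0 := @lebR_ball2_gt0 k 1 ltr01.
have Doo := @lebR_ball2_lty k 1.
have H : lebR k (ball2 k 1) * nu A = lebR k A * nu (ball2 k 1).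
  apply: translation_invariant_double_counting => // [b B mB||x].
  - transitivity (lebR k [set x | B (x *m M + b)%R]) => //.
    transitivity (lebR k [set x | B (x *m M)]) => //.
    rewrite -[RHS](@lebR_shift k (b *m M^T)%R);
      last exact: (measurable_preimage (measurable_mulmx M)).
    by congr (lebR k _); apply/funext => x /=; rewrite mulmxDl MK'.
  - exact: measurable_ball2.
  - by rewrite /ball2/= -scaleN1r dotvZl dotvZr mulrA mulrNN !mul1r.
rewrite nuD nuE muleC in H.
have Dfin : lebR k (ball2 k 1) \is a fin_num by rewrite ge0_fin_numE.
exact: pmule_inj Dfin D0 H.
Qed.

End orthogonal_invariance.
Arguments ball2 {R} k r.
Arguments shell {R} k.

(** * Orthonormal bases of hyperplanes, and Fubini in the direction [xi] *)

Section hyperplane_coordinates.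
Context {R : realType} {k : nat}.
Implicit Types (xi : 'rV[R]_k.+1) (B : 'M[R]_(k, k.+1)).

(* Take the Householder reflection exchanging the first basis vector and xi. *)
Lemma orthogonal_matrix_first_row xi : unit_sphere xi ->
  exists M : 'M[R]_k.+1, M *m M^T = 1%:M /\ row ord0 M = xi.
Proof.
rewrite /unit_sphere/= => xi1.
pose e : 'rV[R]_k.+1 := delta_mx 0 ord0.
have [w wE] : exists w : 'rV[R]_k.+1, w = e - xi by exists (e - xi).
have [w0|w0] := eqVneq w 0.
  exists 1%:M; rewrite trmx1 mulmx1; split => //.
  by rewrite row1; apply/eqP; rewrite -subr_eq0 -/e -wE w0.
pose c := 2 / dotv w w.
have wwE : w *m w^T = (dotv w w)%:M by rewrite [LHS]mx11_scalar dotvE.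
have ww0 : dotv w w != 0 by rewrite dotv_eq0.
have ee : dotv e e = 1.
  by rewrite dotvE trmx_delta mul_delta_mx mxE !eqxx.
(* Both vectors being unit, |w|^2 = 2 - 2 (e, xi) = 2 (e, w). This is what makes the reflection send
   [e] to [e - w = xi]. *)
have ww : dotv w w = 2 * dotv e w.
  rewrite wE -scaleN1r !dotvDl !dotvDr !dotvZl !dotvZr -/e ee xi1 (dotvC xi e).
  lra.
exists (1%:M - c *: (w^T *m w)); split.
  have -> : (1%:M - c *: (w^T *m w))^T = 1%:M - c *: (w^T *m w).
    by apply/matrixP => i j; rewrite !mxE eq_sym !big_ord1 !mxE [w 0 i * _]mulrC.
  rewrite mulmxBl mul1mx mulmxBr mulmx1.
  rewrite -scalemxAl -scalemxAr -mulmxA (mulmxA w) wwE mul_scalar_mx -!scalemxAr !scalerA.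
  rewrite (_ : c * (c * dotv w w) = c + c); last by rewrite /c; field.
  by rewrite scalerDl opprB addrK subrK.
rewrite rowE mulmxBr mulmx1 -scalemxAr mulmxA -/e.
rewrite (_ : e *m w^T = (dotv e w)%:M); last by rewrite [LHS]mx11_scalar dotvE.
have cE : c * dotv e w = 1.
  by rewrite /c ww; field; move: ww0; rewrite ww mulf_eq0 negb_or => /andP[].
by rewrite mul_scalar_mx scalerA cE scale1r wE opprB addrC subrK.
Qed.

(** Drop the first row of an orthogonal matrix whose first row is [xi]. *)
Lemma orthonormal_complement_neq0 xi : unit_sphere xi ->
  orthonormal_complement xi !=set0.
Proof.
move=> /orthogonal_matrix_first_row[M [MM Mxi]]; exists (row' ord0 M); split.
  apply/matrixP => i j; have := congr1 (fun A : 'M[R]_k.+1 => A (lift ord0 i) (lift ord0 j)) MM.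
  rewrite !mxE (inj_eq (@lift_inj _ ord0)) => <-.
  by apply: eq_bigr => l _; rewrite !mxE.
apply/matrixP => i j; have := congr1 (fun A : 'M[R]_k.+1 => A (lift ord0 i) ord0) MM.
rewrite !mxE eq_sym (negbTE (neq_lift ord0 i)) mulr0n => H; rewrite -[RHS]H.
by apply: eq_bigr => l _; rewrite -Mxi !mxE.
Qed.

Lemma row_cons_row_mx s (y : 'rV[R]_k) :
  row_cons s y = row_mx (s%:M : 'M[R]_1) y :> 'rV[R]_(1 + k).
Proof.
apply/rowP => i; case: (unliftP ord0 i) => [j|] ->.
  rewrite row_consS (_ : lift ord0 j = rshift 1 j) ?row_mxEr//.
  exact: val_inj.
rewrite row_cons0 (_ : ord0 = lshift k (ord0 : 'I_1)) ?row_mxEl ?mxE//.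
exact: val_inj.
Qed.

Local Open Scope ereal_scope.

(** Stacking [xi] on top of [B] gives an orthogonal matrix; its invariance reduces the claim to
    slicing along the first coordinate. *)
Lemma lebR_slices xi B (A : set 'rV[R]_k.+1) : unit_sphere xi ->
  orthonormal_complement xi B -> measurable A ->
  lebR k.+1 A =
  \int[lebesgue_measure]_s lebR k [set y | A (s *: xi + y *m B)%R].
Proof.
move=> xi1 [BB Bxi] mA.
pose M : 'M[R]_(1 + k, k.+1) := col_mx xi B.
have MM : M *m M^T = 1%:M.
  rewrite /M tr_col_mx mul_col_row BB Bxi (scalar_mx_block 1%R).
  congr block_mx; first by rewrite [LHS]mx11_scalar -dotvE xi1.
  by rewrite -[LHS]trmxK trmx_mul trmxK Bxi trmx0.
rewrite -(lebR_orth MM mA) lebR_cons; apply: eq_integral => s _.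
congr (lebR k _); apply/funext => y /=.
by rewrite row_cons_row_mx mul_row_col mul_scalar_mx.
Qed.

End hyperplane_coordinates.

(** * Combinations of dilates that isolate one power of t *)

Section dilation_combinations.
Context {R : realType}.
Implicit Types (V : R -> R) (h : nat).

(** Dilation by 2^i multiplies t^j by (2^j)^i, so the combination with the coefficients of a
    polynomial multiplies t^j by the value of that polynomial at 2^j. Hence the roots 2, 2^3, ...,
    2^(2h-1). *)
Definition dilation_poly h : {poly R} :=
  \prod_(j < h) ('X - (2 ^+ j.*2.+1)%:P).

(* This combination of dilates annihilates t, t^3, ..., t^(2h-1). *)
Definition dilation_comb h V (t : R) : R :=
  \sum_(i < h.+1) (dilation_poly h)`_i * V (2 ^+ i * t).

Lemma size_dilation_poly h : size (dilation_poly h) = h.+1.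
Proof. by rewrite size_prod_XsubC /index_enum -enumT size_enum_ord. Qed.

Lemma dilation_comb_exp h j t :
  dilation_comb h (fun s => s ^+ j) t = (dilation_poly h).[2 ^+ j] * t ^+ j.
Proof.
rewrite horner_coef size_dilation_poly big_distrl/=; apply: eq_bigr => i _.
by rewrite exprMn mulrA exprAC.
Qed.

Lemma eq_dilation_comb h V W t : (forall i, (i <= h)%N -> V (2 ^+ i * t) = W (2 ^+ i * t)) ->
  dilation_comb h V t = dilation_comb h W t.
Proof. by move=> VW; apply: eq_bigr => i _; rewrite VW// -ltnS. Qed.

Lemma dilation_combB h V W t :
  dilation_comb h (fun s => V s - W s) t = dilation_comb h V t - dilation_comb h W t.
Proof. by rewrite /dilation_comb -sumrB; apply: eq_bigr => i _; rewrite mulrBr. Qed.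

Lemma dilation_combD h V W t :
  dilation_comb h (fun s => V s + W s) t = dilation_comb h V t + dilation_comb h W t.
Proof. by rewrite /dilation_comb -big_split; apply: eq_bigr => i _; rewrite mulrDr. Qed.

Lemma dilation_combZ h (c : R) V t :
  dilation_comb h (fun s => c * V s) t = c * dilation_comb h V t.
Proof. by rewrite /dilation_comb big_distrr; apply: eq_bigr => i _ /=; rewrite mulrCA. Qed.

Lemma dilation_comb_sum h m (F : 'I_m -> R -> R) t :
  dilation_comb h (fun s => \sum_i F i s) t = \sum_i dilation_comb h (F i) t.
Proof.
by rewrite exchange_big/=; apply: eq_bigr => i _; rewrite big_distrr.
Qed.

Lemma dilation_comb_scale h V (a t : R) :
  dilation_comb h (fun s => V (s * a)) t = dilation_comb h V (t * a).
Proof. by apply: eq_bigr => i _; rewrite mulrA. Qed.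

Lemma dilation_poly_root h j : (j < h)%N -> (dilation_poly h).[2 ^+ j.*2.+1] = 0.
Proof.
move=> jh; rewrite horner_prod (bigD1 (Ordinal jh))//=.
by rewrite hornerXsubC subrr mul0r.
Qed.

Lemma dilation_poly_neq0 h : (dilation_poly h).[2 ^+ h.*2.+1] != 0.
Proof.
rewrite horner_prod; apply/prodf_neq0 => j _; rewrite hornerXsubC subr_eq0.
by rewrite (inj_eq (@ieexprIn R 2 _ _)) ?eqSS ?(inj_eq double_inj) ?gtn_eqF// ?gt_eqF ?ltr1n.
Qed.

(** The even powers cancel in P(s) - P(-s), the odd ones below 2h+1 meet a root of [dilation_poly],
    and the size bound excludes those above. *)
Lemma dilation_comb_odd_poly h (P : {poly R}) t : (size P <= h.*2.+2)%N ->
  dilation_comb h (fun s => P.[s] - P.[- s]) t =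
  2 * P`_(h.*2.+1) * (dilation_poly h).[2 ^+ h.*2.+1] * t ^+ h.*2.+1.
Proof.
move=> sP.
rewrite (@eq_dilation_comb _ _ (fun s => \sum_(j < h.*2.+2) (P`_j * (1 - (-1) ^+ j)) * s ^+ j)).
  rewrite dilation_comb_sum; under eq_bigr do rewrite dilation_combZ dilation_comb_exp.
  rewrite big_ord_recr/= big1 ?add0r => [|[j /= jh] _].
    have -> : (-1 : R) ^+ h.*2.+1 = - 1 by rewrite -signr_odd/= odd_double.
    rewrite opprK; set x := horner _ _; set y := t ^+ _; set z := P`_ _.
    by move: x y z => x y z; ring.
  have [jo|je] := boolP (odd j); last first.
    by rewrite -signr_odd (negbTE je) subrr mulr0 mul0r.
  have jE : j = j./2.*2.+1 by rewrite -[LHS]odd_double_half jo.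
  rewrite jE dilation_poly_root ?mul0r ?mulr0//.
  by move: jh; rewrite {1}jE ltnS ltn_double.
move=> i _; rewrite !(horner_coef_wide _ sP) -sumrB; apply: eq_bigr => j _.
rewrite [(- (_ * _)) ^+ _]exprNn; set x := _ ^+ j; set y := _ ^+ j; set z := P`_ _.
by move: x y z => x y z; ring.
Qed.

Lemma dilation_comb_le h V (C t : R) N : 0 <= C -> 0 < t ->
  (forall s, 0 < s -> s <= 2 ^+ h * t -> `|V s| <= C * s ^+ N) ->
  `|dilation_comb h V t| <=
    (\sum_(i < h.+1) `|(dilation_poly h)`_i| * (2 ^+ h) ^+ N) * C * t ^+ N.
Proof.
move=> C0 t0 VC; apply: le_trans (ler_norm_sum _ _ _) _.
rewrite !big_distrl/=; apply: ler_sum => i _; rewrite normrM -!mulrA ler_wpM2l//.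
have ih : 2 ^+ i * t <= 2 ^+ h * t.
  by rewrite ler_pM2r// ler_weXn2l ?ler1n// -ltnS.
rewrite (le_trans (VC _ _ ih)) ?mulr_gt0 ?exprn_gt0//.
rewrite (mulrCA ((2 ^+ h) ^+ N)) -exprMn ler_wpM2l// lerXn2r ?nnegrE//.
  by rewrite mulr_ge0 ?exprn_ge0 ?ltW.
by rewrite mulr_ge0 ?exprn_ge0 ?ltW.
Qed.

(** The constant coefficient is a division by 0, that is 0: this primitive vanishes at 0. *)
Definition poly_primitive (p : {poly R}) : {poly R} :=
  \poly_(i < (size p).+1) (p`_i.-1 / i%:R).

Lemma deriv_poly_primitive p : (poly_primitive p)^`() = p.
Proof.
apply/polyP => i; rewrite coef_deriv coef_poly ltnS/=.
case: ltnP => ip; last by rewrite mul0rn nth_default.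
by rewrite -[LHS]mulr_natr divfK.
Qed.

Lemma integral_deriv_poly (P : {poly R}) (a b : R) : a < b ->
  (\int[lebesgue_measure]_(x in `[a, b]) (P^`().[x])%:E = (P.[b] - P.[a])%:E)%E.
Proof.
move=> ab; rewrite EFinB; apply: continuous_FTC2 => //.
- by apply: continuous_subspaceT; exact: continuous_horner.
- split; first by move=> x _; exact: derivable_horner.
    by apply: cvg_at_right_filter; exact: continuous_horner.
  by apply: cvg_at_left_filter; exact: continuous_horner.
- by move=> x _; rewrite -derivE.
Qed.

Lemma Rintegral_poly (p : {poly R}) (a : R) : 0 < a ->
  \int[lebesgue_measure]_(x in `[- a, a]) p.[x] =
  (poly_primitive p).[a] - (poly_primitive p).[- a].
Proof.
by move=> a0; rewrite /Rintegral -{1}(deriv_poly_primitive p) integral_deriv_poly// gtrN.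
Qed.

(** With [p] a Taylor polynomial of the section function, only its coefficient of order n - 1 = 2h
    survives. *)
Lemma dilation_comb_integral_poly h (p : {poly R}) t : 0 < t ->
  (size p <= h.*2.+1)%N ->
  dilation_comb h (fun s => \int[lebesgue_measure]_(x in `[- s, s]) p.[x]) t =
  2 * p`_(h.*2) / h.*2.+1%:R * (dilation_poly h).[2 ^+ h.*2.+1] * t ^+ h.*2.+1.
Proof.
move=> t0 sp.
rewrite (@eq_dilation_comb _ _ (fun s => (poly_primitive p).[s] - (poly_primitive p).[- s])).
  rewrite dilation_comb_odd_poly; last by rewrite (leq_trans (size_poly _ _)).
  rewrite coef_poly ltnS/=; case: ltnP => [_|hp]; first by rewrite mulrA.
  by rewrite [p`_(_)]nth_default ?mulr0 ?mul0r.
by move=> i _; rewrite Rintegral_poly// mulr_gt0// exprn_gt0.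
Qed.

End dilation_combinations.

Lemma bounded_integrable d (T : measurableType d) (R : realType)
    (mu : {measure set T -> \bar R}) (D : set T) (f : T -> R) (M : R) :
  measurable D -> (mu D < +oo)%E -> measurable_fun D f ->
  (forall x, D x -> `|f x| <= M) -> mu.-integrable D (EFin \o f).
Proof.
move=> mD muD mf fM; apply: measurable_bounded_integrable => //.
exists M; split; first exact: num_real.
by move=> x Mx y Dy /=; rewrite (le_trans (fM _ Dy))// ltW.
Qed.

(** * Slab volumes, and the exchange of the body with the set of directions *)

Section slab_volumes.
Context {R : realType} {n : nat}.
Implicit Types (A E : set 'rV[R]_n) (x xi : 'rV[R]_n).

Definition slab A xi (tau : R) : set 'rV[R]_n :=
  A `&` [set x | `|dotv x xi| <= tau].

Definition slab_volume A xi tau : R := fine (lebR n (slab A xi tau)).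

Definition norm2 x : R := Num.sqrt (dotv x x).

Lemma norm2_gt0 x : (0 < norm2 x) = (x != 0).
Proof. by rewrite sqrtr_gt0 dotv_gt0. Qed.

Lemma ball2_norm2 (r : R) x : 0 <= r -> ball2 n r x <-> norm2 x <= r.
Proof.
by move=> r0; rewrite /ball2/= -[in X in _ <-> X](ger0_norm r0) -sqrtr_sqr ler_sqrt// sqr_ge0.
Qed.

Lemma measurable_slab A xi tau : measurable A -> measurable (slab A xi tau).
Proof.
move=> mA; apply: measurableI => //; apply: measurable_le_fun.
by apply: measurableT_comp => //; exact: measurable_dotv.
Qed.

Lemma lebR_slab_fin A xi tau : measurable A -> (lebR n A < +oo)%E ->
  lebR n (slab A xi tau) \is a fin_num.
Proof.
move=> mA Aoo; rewrite ge0_fin_numE//; apply: le_lt_trans Aoo.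
by apply: le_measure; rewrite ?inE//; [exact: measurable_slab|exact: subIsetl].
Qed.

Lemma slab_volumeE A xi tau : measurable A -> (lebR n A < +oo)%E ->
  (slab_volume A xi tau)%:E = lebR n (slab A xi tau).
Proof. by move=> mA Aoo; rewrite /slab_volume fineK// lebR_slab_fin. Qed.

Lemma slab_volume_ge0 A xi tau : 0 <= slab_volume A xi tau.
Proof. exact: fine_ge0. Qed.

Lemma slab_volume_le A xi tau : measurable A -> (lebR n A < +oo)%E ->
  slab_volume A xi tau <= fine (lebR n A).
Proof.
move=> mA Aoo; rewrite fine_le ?ge0_fin_numE//.
  by rewrite -ge0_fin_numE// lebR_slab_fin.
by apply: le_measure; rewrite ?inE//; [exact: measurable_slab|exact: subIsetl].
Qed.

Lemma measurable_slab_pair tau :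
  measurable [set p : 'rV[R]_n * 'rV[R]_n | `|dotv p.2 p.1| <= tau].
Proof.
apply: measurable_le_fun; apply: measurableT_comp => //.
exact: (measurable_dotv measurable_snd measurable_fst).
Qed.

Lemma measurable_slab_volume A tau : measurable A -> (lebR n A < +oo)%E ->
  measurable_fun setT (fun xi => slab_volume A xi tau).
Proof.
move=> mA Aoo; apply/measurable_EFinP.
pose S := [set p : 'rV[R]_n * 'rV[R]_n | A p.2] `&` [set p | `|dotv p.2 p.1| <= tau].
rewrite (_ : _ \o _ = lebR n \o xsection S).
  apply: measurable_fun_xsection; apply: measurableI.
    exact: (measurable_preimage measurable_snd mA).
  exact: measurable_slab_pair.
apply/funext => xi /=; rewrite slab_volumeE//; congr (lebR n _).
by apply/funext => x; rewrite /xsection/=; apply/propext; rewrite inE.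
Qed.

Lemma integrable_slab_volume A E tau : measurable A -> (lebR n A < +oo)%E ->
  measurable E -> (lebR n E < +oo)%E ->
  (lebR n).-integrable E (EFin \o (fun xi => slab_volume A xi tau)).
Proof.
move=> mA Aoo mE Eoo.
apply: (@bounded_integrable _ _ _ _ _ _ (fine (lebR n A))) => //.
  by apply: measurable_funTS; exact: measurable_slab_volume.
by move=> xi _; rewrite ger0_norm ?slab_volume_ge0// slab_volume_le.
Qed.

(** The condition |(x, xi)| <= tau is symmetric in x and xi, so both sides are the product measure
    of one set of pairs. *)
Lemma slab_volume_exchange A E tau : measurable A -> (lebR n A < +oo)%E ->
  measurable E -> (lebR n E < +oo)%E ->
  \int[lebR n]_(xi in E) slab_volume A xi tau =
  \int[lebR n]_(x in A) slab_volume E x tau.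
Proof.
move=> mA Aoo mE Eoo; congr fine.
pose S := [set p : 'rV[R]_n * 'rV[R]_n | E p.1] `&`
  ([set p : 'rV[R]_n * 'rV[R]_n | A p.2] `&` [set p | `|dotv p.2 p.1| <= tau]).
have mS : measurable S.
  apply: measurableI; first exact: (measurable_preimage measurable_fst mE).
  apply: measurableI; first exact: (measurable_preimage measurable_snd mA).
  exact: measurable_slab_pair.
transitivity ((lebR n \x lebR n) S)%E.
  rewrite integral_mkcond; apply: eq_integral => xi _ /=.
  rewrite patchE; case: ifPn => xiE.
    rewrite slab_volumeE//; congr (lebR n _); apply/funext => x.
    rewrite /xsection/=; apply/propext; rewrite inE/=; split=> [[]|[_ []]]//.
    by rewrite inE in xiE.
  rewrite (_ : xsection _ _ = set0) ?measure0//.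
  rewrite /xsection; apply/seteqP; split => // x /=; rewrite inE => -[/= Exi _].
  by rewrite mem_set in xiE.
rewrite (@product_measure_unique _ _ _ _ _ _ _ (lebR n \x^ lebR n)%E)//; last first.
  by move=> *; exact: product_measure2E.
rewrite [RHS]integral_mkcond; apply: eq_integral => x _ /=.
rewrite patchE; case: ifPn => xA.
  rewrite slab_volumeE//; congr (lebR n _); apply/funext => xi.
  rewrite /ysection/=; apply/propext; rewrite inE /S /slab/= (dotvC x); split=> [[? []]|[? ?]]//.
  by rewrite inE in xA.
rewrite (_ : ysection _ _ = set0) ?measure0//.
rewrite /ysection; apply/seteqP; split => // xi /=; rewrite inE => -[/= _ [Ax _]].
by rewrite mem_set in xA.
Qed.

Lemma slab_volumeD A E xi tau : measurable A -> measurable E -> E `<=` A ->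
  (lebR n A < +oo)%E ->
  slab_volume (A `\` E) xi tau = slab_volume A xi tau - slab_volume E xi tau.
Proof.
move=> mA mE EA Aoo.
have Eoo : (lebR n E < +oo)%E by apply: le_lt_trans Aoo; apply: le_measure; rewrite ?inE.
rewrite {1}/slab_volume (_ : slab _ _ _ = slab A xi tau `\` slab E xi tau).
  rewrite measureD//; [|exact: measurable_slab..|]; last first.
    by rewrite -ge0_fin_numE// lebR_slab_fin.
  rewrite setIC (setIidl _); last by move=> x [/EA].
  by rewrite fineB// lebR_slab_fin.
apply/seteqP; split => x; first by move=> [[? ?] ?]; split => // -[].
by move=> [[? ?] H]; do 2?split => //; apply: contra_not H.
Qed.

Lemma slab_normalize A xi tau : xi != 0 ->
  slab A xi tau = slab A ((norm2 xi)^-1 *: xi) (tau / norm2 xi).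
Proof.
rewrite -norm2_gt0 => xi0; congr (_ `&` _); apply/funext => x /=; apply/propext.
by rewrite dotvZr normrM gtr0_norm ?invr_gt0// mulrC ler_pM2r ?invr_gt0.
Qed.

Lemma unit_sphere_normalize xi : xi != 0 -> unit_sphere ((norm2 xi)^-1 *: xi).
Proof.
move=> xi0; rewrite /unit_sphere/= dotvZl dotvZr mulrA -expr2 exprVn.
by rewrite sqr_sqrtr ?dotv_ge0// mulVf// dotv_eq0.
Qed.

End slab_volumes.

Lemma Rintegral_dilation_comb d (T : measurableType d) (R : realType)
    (mu : {measure set T -> \bar R}) (D : set T) (V : T -> R -> R) h t :
  measurable D ->
  (forall s, mu.-integrable D (EFin \o (fun x => V x s))) ->
  \int[mu]_(x in D) dilation_comb h (V x) t =
  dilation_comb h (fun s => \int[mu]_(x in D) V x s) t.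
Proof.
move=> mD iV; rewrite {1}/Rintegral.
under eq_integral do rewrite /dilation_comb -sumEFin.
have iq (i : 'I_h.+1) : mu.-integrable D
    (fun x => ((dilation_poly h)`_i * V x (2 ^+ i * t))%:E).
  by under eq_fun do rewrite EFinM; apply: integrableZl => //; exact: (iV (2 ^+ i * t)).
rewrite integral_sum// -sum_fine => [|i _]; last exact: integrable_fin_num.
apply: eq_bigr => i _; rewrite -[LHS]/(\int[mu]_(x in D) ((dilation_poly h)`_i * V x (2 ^+ i * t)))
  RintegralZl//.
Qed.

(** * Slabs of balls in odd dimension *)

Section ball_slabs.
Context {R : realType} {h : nat}.
Let k := h.*2.
Implicit Types (xi : 'rV[R]_k.+1).

Definition ball_volume : R := fine (lebR k (ball2 k (1 : R))).

Lemma ball_volume_gt0 : 0 < ball_volume.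
Proof. by rewrite fine_gt0// lebR_ball2_gt0 ?ltr01// lebR_ball2_lty. Qed.

(** Up to [ball_volume], the volume of the section at height x of the ball of radius [r]: the radius
    sqrt(r^2 - x^2) to the even power 2h. *)
Definition ball_section (r : R) : {poly R} := ((r ^+ 2)%:P - 'X^2) ^+ h.

Lemma lebR_scaled_ball (c : R) : 0 < c ->
  lebR k [set y | dotv y y <= c] = (ball_volume * c ^+ h)%:E.
Proof.
move=> c0; pose a := Num.sqrt c.
have a0 : 0 < a by rewrite sqrtr_gt0.
have a2 : a ^+ 2 = c by rewrite sqr_sqrtr// ltW.
have mA : measurable [set y : 'rV[R]_k | dotv y y <= c].
  by rewrite -a2; exact: measurable_ball2.
rewrite -(lebR_affine 0 a0 mA) /k -{1}mul2n exprM a2 mulrC EFinM; congr (_ * _)%E.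
rewrite /ball_volume fineK ?ge0_fin_numE ?lebR_ball2_lty//.
congr (lebR _ _); apply/funext => y /=.
by rewrite /ball2/= addr0 dotvZl dotvZr mulrA -expr2 a2 expr1n -ler_pdivlMl// mulVf ?gt_eqF.
Qed.

Lemma slab_volume_ball_unit (r s : R) xi : unit_sphere xi -> 0 < s -> s < r ->
  slab_volume (ball2 k.+1 r) xi s =
  ball_volume * \int[lebesgue_measure]_(x in `[- s, s]) (ball_section r).[x].
Proof.
move=> xi1 s0 sr; have [B xiB] := orthonormal_complement_neq0 xi1.
have [BB Bxi] := xiB.
have mb := @measurable_ball2 R k.+1 r.
rewrite /slab_volume (lebR_slices xi1 xiB); last exact: measurable_slab.
have p_cont : {within `[- s, s], continuous (horner (ball_section r))}.
  by apply: continuous_subspaceT; exact: continuous_horner.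
have ip := continuous_compact_integrable (@segment_compact R (- s) s) p_cont.
rewrite -RintegralZl//; congr fine; rewrite [RHS]integral_mkcond.
apply: eq_integral => x _; rewrite patchE.
have xiy (y : 'rV[R]_k) : dotv xi (y *m B) = 0.
  by rewrite dotvC dotvE -mulmxA Bxi mulmx0 mxE.
have dx (y : 'rV[R]_k) : dotv (x *: xi + y *m B) xi = x.
  by rewrite dotvDl dotvZl xi1 mulr1 dotvC xiy addr0.
have dn (y : 'rV[R]_k) : dotv (x *: xi + y *m B) (x *: xi + y *m B) = x ^+ 2 + dotv y y.
  rewrite dotvDl !dotvDr !dotvZl !dotvZr xi1 xiy [dotv (_ *m _) xi]dotvC xiy dotv_mulmx_orth//.
  by rewrite mulr1 !mulr0 add0r addr0 expr2.
case: ifPn => xs.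
  have xs' : `|x| <= s by move: xs; rewrite inE/= in_itv/= -ler_norml.
  rewrite /ball_section horner_exp !hornerE -lebR_scaled_ball; last first.
    rewrite subr_gt0 -real_normK ?num_real// ltr_pXn2r ?nnegrE//.
      exact: le_lt_trans sr.
    by rewrite ltW// (lt_trans s0).
  congr (lebR _ _); apply/funext => y; apply/propext; rewrite /slab/ball2/= dn dx lerBrDl.
  by split => [[]|].
rewrite (_ : [set y | _] = set0) ?measure0//; apply/seteqP; split => // y /=.
rewrite /slab/= dx => -[_ xs'].
by move/negP: xs; apply; apply/mem_set; rewrite /= in_itv/= -ler_norml.
Qed.
Lemma size_ball_section r : size (ball_section r) = k.+1.
Proof.
have s3 : size ((r ^+ 2)%:P - 'X^2 : {poly R}) = 3%N.
  by rewrite -opprB size_polyN size_XnsubC.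
have p0 : ball_section r != 0 by rewrite expf_neq0// -size_poly_eq0 s3.
by rewrite -(prednK (n := size _)) ?lt0n ?size_poly_eq0// size_exp s3 mul2n.
Qed.

Lemma lead_coef_ball_section r : (ball_section r)`_k = (-1) ^+ h.
Proof.
have -> : (ball_section r)`_k = lead_coef (ball_section r).
  by rewrite /lead_coef size_ball_section.
by rewrite lead_coef_exp -opprB lead_coefN (monicP (monicXnsubC _ _)).
Qed.

(** Free of the radius, since only the leading coefficient of [ball_section] contributes to it. *)
Definition ball_constant : R := ball_volume *
  (2 * (-1) ^+ h / k.+1%:R * (dilation_poly h).[2 ^+ k.+1]).

Lemma ball_constant_neq0 : ball_constant != 0.
Proof.
apply: mulf_neq0; first by rewrite gt_eqF// ball_volume_gt0.
apply: mulf_neq0; last exact: dilation_poly_neq0.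
by rewrite !mulf_eq0 invr_eq0 !pnatr_eq0 signr_eq0.
Qed.

(** The last hypothesis keeps the widest slab, of half-width 2^h t / |xi|, strictly inside the ball,
    where the polynomial formula for the sections is valid. *)
Lemma dilation_comb_ball (r t : R) xi : xi != 0 -> 0 < t ->
  2 ^+ h * t < r * norm2 xi ->
  dilation_comb h (fun s => slab_volume (ball2 k.+1 r) xi s) t =
  ball_constant * (t / norm2 xi) ^+ k.+1.
Proof.
move=> xi0 t0 tr; have nxi : 0 < norm2 xi by rewrite norm2_gt0.
pose I s := \int[lebesgue_measure]_(x in `[- s, s]) (ball_section r).[x].
rewrite (@eq_dilation_comb _ _ _ (fun s => ball_volume *
    I (s * (norm2 xi)^-1))).
  rewrite dilation_combZ (dilation_comb_scale h I) dilation_comb_integral_poly ?divr_gt0//.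
    by rewrite lead_coef_ball_section mulrA.
  by rewrite size_ball_section.
move=> i ih; rewrite /slab_volume slab_normalize//.
rewrite -[LHS]/(slab_volume _ _ _) slab_volume_ball_unit//.
- exact: unit_sphere_normalize.
- by rewrite divr_gt0// mulr_gt0// exprn_gt0.
- rewrite ltr_pdivrMr//; apply: le_lt_trans tr.
  by rewrite ler_pM2r// ler_weXn2l ?ler1n.
Qed.

Lemma ball2_le (r s : R) : 0 <= r -> r <= s -> ball2 k.+1 r `<=` ball2 k.+1 s.
Proof.
move=> r0 rs x /= xr; apply: le_trans xr _.
by rewrite lerXn2r ?nnegrE// (le_trans r0).
Qed.

Lemma shell_norm2 xi : shell k.+1 xi -> [/\ xi != 0, 1 <= norm2 xi & norm2 xi <= 2].
Proof.
move=> [x2 x1].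
have n1 : 1 < norm2 xi by rewrite ltNge; apply/negP => n1; apply: x1; exact/ball2_norm2.
split; [|exact: ltW|exact/ball2_norm2].
by rewrite -norm2_gt0 (lt_trans ltr01).
Qed.

Lemma lebR_shell_gt0 : 0 < fine (lebR k.+1 (@shell R k.+1)).
Proof.
have lt12 : (lebR k.+1 (ball2 k.+1 1) < lebR k.+1 (ball2 k.+1 (2 : R)))%E.
  have <- : ((2 ^+ k.+1)%:E * lebR k.+1 (ball2 k.+1 1) = lebR k.+1 (ball2 k.+1 (2 : R)))%E.
    rewrite -(@lebR_affine _ _ 2 0 (ball2 k.+1 2)) ?ltr0n//; last exact: measurable_ball2.
    congr (_ * lebR _ _)%E; apply/funext => x /=; apply/propext.
    rewrite /ball2/= addr0 dotvZl dotvZr mulrA -expr2 expr1n -ler_pdivlMl ?exprn_gt0//.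
    by rewrite mulVf// gt_eqF// exprn_gt0.
  have := @lebR_ball2_gt0 R k.+1 1 ltr01; have := @lebR_ball2_lty R k.+1 1.
  case: (lebR _ _) => // v _; rewrite !lte_fin => v0.
  by rewrite ltr_pMl// exprn_egt1// ltr1n.
rewrite fine_gt0// lebR_shell_lty andbT measureD ?lebR_ball2_lty//; [|exact: measurable_ball2..].
by rewrite setIidr ?sube_gt0//; apply: ball2_le; rewrite ?ler1n.
Qed.

End ball_slabs.

(** * Averaging over the shell, and the contradiction for small t *)

Section slab_average.
Context {R : realType} (h : nat).
Let k := h.*2.
Variables (K : set 'rV[R]_k.+1) (eps C delta : R).
Hypotheses (mK : measurable K) (Koo : (lebR k.+1 K < +oo)%E) (eps0 : 0 < eps)
  (epsK : ball2 k.+1 eps `<=` K) (delta0 : 0 < delta).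
Hypothesis slab_bound : forall xi, shell k.+1 xi -> forall t, 0 < t -> t < delta ->
  `|dilation_comb h (fun s => slab_volume K xi s) t| <= C * t ^+ k.+2.

Notation E := (@shell R k.+1).
Notation B := (ball2 k.+1 eps).
Notation mE := (@measurable_shell R k.+1).
Notation Eoo := (@lebR_shell_lty R k.+1).
Notation beta := (@ball_constant R h).

Let mB : measurable B. Proof. exact: measurable_ball2. Qed.
Let Boo : (lebR k.+1 B < +oo)%E. Proof. exact: lebR_ball2_lty. Qed.

(** After the exchange it is the shell that is cut, by slabs in the direction [x]. Its two balls
    yield the same [ball_constant], hence the difference 0. *)
Let dilation_comb_shell x t : 0 < t -> 2 ^+ h * t < eps -> ~ B x ->
  dilation_comb h (fun s => slab_volume E x s) t = 0.
Proof.
move=> t0 te Bx.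
have ex : eps < norm2 x by rewrite ltNge; apply/negP => xe;
  apply: Bx; apply/ball2_norm2 => //; exact: ltW.
have x0 : x != 0 by rewrite -norm2_gt0 (lt_trans eps0).
have tx : 2 ^+ h * t < norm2 x by exact: lt_trans ex.
transitivity (dilation_comb h
  (fun s => slab_volume (ball2 k.+1 2) x s - slab_volume (ball2 k.+1 1) x s) t).
  apply: eq_dilation_comb => i _; apply: slab_volumeD.
  - exact: measurable_ball2.
  - exact: measurable_ball2.
  - by apply: ball2_le; rewrite ?ler1n.
  - exact: lebR_ball2_lty.
rewrite dilation_combB !dilation_comb_ball ?subrr//.
  by rewrite mul1r.
by rewrite (lt_le_trans tx)// ler_peMl ?ler1n// ltW// norm2_gt0.
Qed.

Let average A s := \int[lebR k.+1]_(xi in E) slab_volume A xi s.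

(** The two sides differ by the points of [K] outside [B], and each of these contributes 0 once the
    integrals are exchanged. *)
Let average_difference t : 0 < t -> 2 ^+ h * t < eps ->
  dilation_comb h (average K) t = dilation_comb h (average B) t.
Proof.
move=> t0 te; apply/eqP; rewrite -subr_eq0 -dilation_combB; apply/eqP.
have mKB : measurable (K `\` B) by exact: measurableD.
have KBoo : (lebR k.+1 (K `\` B) < +oo)%E.
  by apply: le_lt_trans Koo; apply: le_measure; rewrite ?inE//; exact: subIsetl.
transitivity (dilation_comb h (fun s =>
    \int[lebR k.+1]_(x in K `\` B) slab_volume E x s) t).
  apply: eq_dilation_comb => i _.
  rewrite -(slab_volume_exchange _ mKB KBoo mE Eoo) /average -RintegralB.
  - by apply: eq_Rintegral => xi _; rewrite slab_volumeD.
  - exact: mE.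
  - exact: (integrable_slab_volume _ mK Koo mE Eoo).
  - exact: (integrable_slab_volume _ mB Boo mE Eoo).
rewrite -(Rintegral_dilation_comb _ _ mKB); last first.
  by move=> s; exact: (integrable_slab_volume _ mE Eoo mKB KBoo).
transitivity (\int[lebR k.+1]_(x in K `\` B) (0 : R)).
  by apply: eq_Rintegral => x /set_mem [_ Bx]; exact: dilation_comb_shell.
by rewrite Rintegral_cst// mul0r.
Qed.

(** Multiplying by [beta] makes the contribution of the ball positive whatever the sign of [beta].
    The t / 2 comes from [norm2 xi <= 2] on the shell. *)
Let small_t_lower t : 0 < t -> t < delta -> 2 ^+ h * t < eps ->
  beta ^+ 2 * (t / 2) ^+ k.+1 * fine (lebR k.+1 E) <=
  `|beta| * (C * t ^+ k.+2) * fine (lebR k.+1 E).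
Proof.
move=> t0 td te.
have iA A : measurable A -> (lebR k.+1 A < +oo)%E -> forall s,
    (lebR k.+1).-integrable E (EFin \o (fun xi => slab_volume A xi s)).
  by move=> mA Aoo s; exact: (integrable_slab_volume _ mA Aoo mE Eoo).
have iD A : measurable A -> (lebR k.+1 A < +oo)%E ->
    (lebR k.+1).-integrable E (EFin \o (fun xi => dilation_comb h (fun s => slab_volume A xi s) t)).
  move=> mA Aoo; rewrite (_ : _ \o _ = (fun xi => \sum_(i < h.+1)
      ((dilation_poly h)`_i * slab_volume A xi (2 ^+ i * t))%:E)%E).
    apply: integrable_sum => [|i _]; first exact: mE.
    under eq_fun do rewrite EFinM; apply: integrableZl; first exact: mE.
    exact: iA.
  by apply/funext => xi /=; rewrite sumEFin.
have cE (c : R) : (lebR k.+1).-integrable E (EFin \o (fun=> c)).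
  by apply: (@bounded_integrable _ _ _ _ _ (fun=> c) `|c| mE Eoo) => //; exact: measurable_cst.
have iZ (f : 'rV[R]_k.+1 -> R) : (lebR k.+1).-integrable E (EFin \o f) ->
    (lebR k.+1).-integrable E (EFin \o (fun xi => beta * f xi)).
  by move=> fi; rewrite (_ : _ \o _ = (fun xi => beta%:E * (EFin \o f) xi)%E)//;
    apply: integrableZl; [exact: mE|].
rewrite -!Rintegral_cst; [|exact: mE..].
apply: (@le_trans _ _ (beta * dilation_comb h (average B) t)).
  rewrite -(Rintegral_dilation_comb _ _ mE (iA _ mB Boo)) -RintegralZl; [|exact: mE|exact: iD].
  apply: le_Rintegral; [exact: mE|exact: cE| |].
    by apply: iZ; exact: iD.
  move=> xi /shell_norm2[xi0 xi1 xi2]; rewrite dilation_comb_ball//; last first.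
    by rewrite (lt_le_trans te)// ler_peMr// ltW.
  have n0 : 0 < norm2 xi by rewrite norm2_gt0.
  have t2 : t / 2 <= t / norm2 xi by rewrite ler_pM2l// lef_pV2// posrE.
  have t20 : 0 <= t / 2 by rewrite ltW// divr_gt0.
  by rewrite mulrA -expr2 ler_wpM2l ?sqr_ge0// lerXn2r ?nnegrE// (le_trans t20).
rewrite -average_difference// -(Rintegral_dilation_comb _ _ mE (iA _ mK Koo)) -RintegralZl;
  [|exact: mE|exact: iD].
apply: le_Rintegral; [exact: mE| |exact: cE|].
  by apply: iZ; exact: iD.
move=> xi Exi; apply: le_trans (ler_norm _) _; rewrite normrM ler_wpM2l//.
exact: slab_bound.
Qed.

Lemma slab_average_contradiction : False.
Proof.
set a := beta ^+ 2 / 2 ^+ k.+1.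
have a0 : 0 < a.
  by apply: divr_gt0; [rewrite exprn_even_gt0//= ball_constant_neq0|rewrite exprn_gt0].
set b := `|beta| * `|C| + 1.
have b0 : 0 < b by rewrite ltr_wpDl// mulr_ge0.
have h0 : 0 < (2 : R) ^+ h by rewrite exprn_gt0.
(* The three terms secure t < delta, 2^h t < eps and t b < a. The last one is incompatible with
   bounding a t^(k+1) by a multiple of t^(k+2). *)
pose t := Num.min (delta / 2) (Num.min (eps / 2 / 2 ^+ h) (a / b / 2)).
have t0 : 0 < t.
  by rewrite /t !lt_min; do 2?(apply/andP; split); do ?apply: divr_gt0 => //.
have td : t < delta by rewrite gt_min ltr_pdivrMr// mulr_natr mulr2n ltrDl delta0.
have te : 2 ^+ h * t < eps.
  rewrite mulrC -ltr_pdivlMr// !gt_min ltr_pM2r ?invr_gt0//.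
  by rewrite [eps / 2 < eps]ltr_pdivrMr// mulr_natr mulr2n ltrDl eps0 orbT.
have ta : t * b < a.
  rewrite -ltr_pdivlMr// !gt_min [a / b / 2 < _]ltr_pdivrMr// mulr_natr mulr2n ltrDl divr_gt0//.
  by rewrite !orbT.
have := small_t_lower t0 td te; rewrite ler_pM2r ?lebR_shell_gt0// leNgt => /negP; apply.
have -> : beta ^+ 2 * (t / 2) ^+ k.+1 = a * t ^+ k.+1.
  by rewrite expr_div_n mulrA mulrAC.
have -> : `|beta| * (C * t ^+ k.+2) = `|beta| * C * t * t ^+ k.+1.
  by rewrite exprS !mulrA.
rewrite ltr_pM2r ?exprn_gt0//; apply: le_lt_trans ta; rewrite mulrC ler_pM2l//.
by rewrite /b ler_wpDr// ler_wpM2l// ler_norm.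
Qed.

End slab_average.

(** * Functions of t with derivatives bounded uniformly in a parameter *)

Section bounded_derivatives.
Context {R : realType} {T : Type} (D : set T) (d : R).
Implicit Types f g : T -> R -> R.

Definition unif_bounded f :=
  exists M, forall w, D w -> forall t : R, `|t| < d -> `|f w t| <= M.

(** Each order has one bound for all parameters in [D]; the derivative of order [m] itself is only
    required to be bounded. *)
Fixpoint bounded_derivs m f : Prop := unif_bounded f /\
  match m with
  | 0 => True
  | m'.+1 => (forall w, D w -> forall t : R, `|t| < d -> derivable (f w) t 1) /\
             bounded_derivs m' (fun w => derive1 (f w))
  end.

Lemma near_norm_lt (t : R) : `|t| < d -> \forall s \near t, `|s| < d.
Proof.
move=> td; apply/nbhs_ballP; exists (d - `|t|); rewrite /= ?subr_gt0// => s.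
rewrite -ball_normE/= => ts; rewrite -[s](subKr t) (le_lt_trans (ler_normB _ _))//.
by rewrite -ltrBrDl.
Qed.

Lemma near_eq_on f g w : (forall t : R, `|t| < d -> f w t = g w t) ->
  forall t : R, `|t| < d -> \forall s \near t, f w s = g w s.
Proof. by move=> fg t td; near=> s; apply: fg; near: s; exact: near_norm_lt.
Unshelve. all: by end_near. Qed.

Lemma bounded_derivs_ext m f g :
  (forall w, D w -> forall t : R, `|t| < d -> f w t = g w t) ->
  bounded_derivs m f -> bounded_derivs m g.
Proof.
elim: m f g => [|m IHm] f g fg /= [[M fM] df].
  by split => //; exists M => w Dw t td; rewrite -fg// fM.
have [fd {}df] := df; split; first by exists M => w Dw t td; rewrite -fg// fM.
split=> [w Dw t td|].
  by apply: near_eq_derivable (fd _ Dw _ td); apply: near_eq_on td; exact: fg.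
apply: IHm df => w Dw t td; rewrite !derive1E; apply: near_eq_derive.
by apply: near_eq_on td; exact: fg.
Qed.

Lemma bounded_derivs_bounded m f : bounded_derivs m f -> unif_bounded f.
Proof. by case: m => [|m] []. Qed.

(** The introduction rule behind the closure properties: on the interval the derivative may be given
    by any expression [f'], in place of [derive1]. *)
Lemma bounded_derivsS m f f' : unif_bounded f ->
  (forall w, D w -> forall t : R, `|t| < d -> is_derive t (1 : R) (f w) (f' w t)) ->
  bounded_derivs m f' -> bounded_derivs m.+1 f.
Proof.
move=> fM df bf' /=; do 2!split => //.
  by move=> w Dw t td; have [] := df w Dw t td.
apply: bounded_derivs_ext bf' => w Dw t td.
by rewrite derive1E; have [_ ->] := df w Dw t td.
Qed.

Lemma bounded_derivs_is_derive m f : bounded_derivs m.+1 f ->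
  forall w, D w -> forall t : R, `|t| < d -> is_derive t (1 : R) (f w) (derive1 (f w) t).
Proof.
by move=> [_ [fd _]] w Dw t td; rewrite derive1E; apply/derivableP/fd.
Qed.

Lemma bounded_derivsW m f : bounded_derivs m.+1 f -> bounded_derivs m f.
Proof.
elim: m f => [|m IHm] f; first by move=> [].
by move=> [fM [fd df]]; split => //; split => //; exact: IHm.
Qed.

Lemma unif_boundedD f g : unif_bounded f -> unif_bounded g ->
  unif_bounded (fun w t => f w t + g w t).
Proof.
move=> [M fM] [N gN]; exists (M + N) => w Dw t td.
by rewrite (le_trans (ler_normD _ _))// lerD ?fM ?gN.
Qed.

Lemma unif_boundedM f g : unif_bounded f -> unif_bounded g ->
  unif_bounded (fun w t => f w t * g w t).
Proof.
move=> [M fM] [N gN]; exists (M * N) => w Dw t td.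
by rewrite normrM ler_pM ?fM ?gN.
Qed.

Lemma bounded_derivs_cst m (c : T -> R) M : (forall w, D w -> `|c w| <= M) ->
  bounded_derivs m (fun w _ => c w).
Proof.
elim: m c M => [|m IHm] c M cM; first by split => //; exists M => w /cM.
apply: (@bounded_derivsS _ _ (fun _ _ => 0)); first by exists M => w /cM.
have H := IHm (fun=> 0) 0; by apply: H => w _; rewrite normr0.
Qed.

Lemma bounded_derivsD m f g : bounded_derivs m f -> bounded_derivs m g ->
  bounded_derivs m (fun w t => f w t + g w t).
Proof.
elim: m f g => [|m IHm] f g bf bg.
  by split => //; apply: unif_boundedD; exact: (@bounded_derivs_bounded 0).
apply: (@bounded_derivsS _ _ (fun w t => derive1 (f w) t + derive1 (g w) t)).
- by apply: unif_boundedD; exact: (@bounded_derivs_bounded m.+1).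
- move=> w Dw t td; have df := bounded_derivs_is_derive bf Dw td.
  by have dg := bounded_derivs_is_derive bg Dw td; exact: is_deriveD.
- by apply: IHm; [case: bf => _ []|case: bg => _ []].
Qed.

Lemma bounded_derivsM m f g : bounded_derivs m f -> bounded_derivs m g ->
  bounded_derivs m (fun w t => f w t * g w t).
Proof.
elim: m f g => [|m IHm] f g bf bg.
  by split => //; apply: unif_boundedM; exact: (@bounded_derivs_bounded 0).
apply: (@bounded_derivsS _ _ (fun w t => f w t * derive1 (g w) t + g w t * derive1 (f w) t)).
- by apply: unif_boundedM; exact: (@bounded_derivs_bounded m.+1).
- move=> w Dw t td; have df := bounded_derivs_is_derive bf Dw td.
  by have dg := bounded_derivs_is_derive bg Dw td; exact: is_deriveM.
- apply: bounded_derivsD; apply: IHm; try exact: bounded_derivsW.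
    by case: bg => _ [].
  by case: bf => _ [].
Qed.

Lemma bounded_derivsX m f N : bounded_derivs m f ->
  bounded_derivs m (fun w t => f w t ^+ N).
Proof.
move=> bf; elim: N => [|N IHN].
  by apply: (@bounded_derivs_cst _ (fun=> 1) 1) => w _; rewrite normr1.
by under eq_fun do under eq_fun do rewrite exprS; exact: bounded_derivsM.
Qed.

Lemma bounded_derivsN m f : bounded_derivs m f ->
  bounded_derivs m (fun w t => - f w t).
Proof.
move=> bf; under eq_fun do under eq_fun do rewrite -mulN1r.
apply: bounded_derivsM bf.
by apply: (@bounded_derivs_cst _ (fun=> -1) 1) => w _; rewrite normrN1.
Qed.

Lemma bounded_derivs_sum m (I : Type) (r : seq I) (F : I -> T -> R -> R) :
  (forall i, bounded_derivs m (F i)) ->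
  bounded_derivs m (fun w t => \sum_(i <- r) F i w t).
Proof.
move=> bF; elim: r => [|i r IHr].
  under eq_fun do under eq_fun do rewrite big_nil.
  by apply: (@bounded_derivs_cst _ (fun=> 0) 0) => w _; rewrite normr0.
by under eq_fun do under eq_fun do rewrite big_cons; exact: bounded_derivsD.
Qed.

Lemma bounded_derivsV m f c : 0 < c ->
  (forall w, D w -> forall t : R, `|t| < d -> c <= f w t) ->
  bounded_derivs m f -> bounded_derivs m (fun w t => (f w t)^-1).
Proof.
move=> c0 fc; have bV : unif_bounded (fun w t => (f w t)^-1).
  exists c^-1 => w Dw t td; have fwt := fc _ Dw _ td.
  have f0 : 0 < f w t by exact: lt_le_trans fwt.
  by rewrite gtr0_norm ?invr_gt0// lef_pV2.
elim: m => [|m IHm] bf; first by split.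
apply: (@bounded_derivsS _ _ (fun w t => - ((f w t)^-1 * (f w t)^-1 * derive1 (f w) t))) => //.
  move=> w Dw t td; have f0 : f w t != 0 by rewrite gt_eqF// (lt_le_trans c0)// fc.
  have df := bounded_derivs_is_derive bf Dw td.
  have [dfw dE] := df; apply: DeriveDef; first exact: derivableV.
  by rewrite deriveV// dE scaleNr -exprVn expr2.
apply: bounded_derivsN; apply: bounded_derivsM; last by case: bf => _ [].
by apply: bounded_derivsM; apply: IHm; exact: bounded_derivsW.
Qed.

End bounded_derivatives.

(** Mean value theorem between 0 and t. There is no factor 1/(m+1), because the bound at t is taken
    for the whole segment. *)
Lemma norm_le_of_derive {R : realType} (d M : R) m (g g' : R -> R) : g 0 = 0 ->
  (forall t : R, `|t| < d -> is_derive t (1 : R) g (g' t)) ->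
  (forall t : R, `|t| < d -> `|g' t| <= M * `|t| ^+ m) ->
  forall t : R, `|t| < d -> `|g t| <= M * `|t| ^+ m.+1.
Proof.
move=> g0 dg g'M t td.
have M0 : 0 <= M * `|t| ^+ m by apply: le_trans (g'M _ td).
have bnd (c : R) : `|c| <= `|t| -> `|g' c| <= M * `|t| ^+ m.
  move=> ct; have cd : `|c| < d by exact: le_lt_trans td.
  apply: le_trans (g'M _ cd) _.
  (* Monotonicity in |c| requires M >= 0, which [M0] yields only when t is nonzero. *)
  have [t0|t0] := eqVneq t 0.
    by move: ct; rewrite t0 normr0 normr_le0 => /eqP ->; rewrite normr0.
  rewrite ler_wpM2l ?lerXn2r ?nnegrE//.
  by move: M0; rewrite pmulr_lge0// exprn_gt0// normr_gt0.
have mvt (a b : R) : a < b -> (forall x, x \in `[a, b] -> `|x| <= `|t|) ->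
    `|g b - g a| <= M * `|t| ^+ m * (b - a).
  move=> ab abt.
  have dab x : x \in `[a, b] -> is_derive x (1 : R) g (g' x).
    by move=> /abt xt; apply: dg; exact: le_lt_trans td.
  have dab' x : x \in `]a, b[ -> is_derive x (1 : R) g (g' x).
    by move=> /subset_itv_oo_cc; exact: dab.
  have gc : {within `[a, b], continuous g}.
    by apply: derivable_within_continuous => x xab; have [] := dab x xab.
  have [c cab ->] := MVT ab dab' gc.
  rewrite normrM (@gtr0_norm _ (b - a)) ?subr_gt0// ler_pM2r ?subr_gt0//.
  by apply: bnd; apply: abt; exact: subset_itv_oo_cc.
have [t0|t0|t0] := ltgtP t 0.
- have := mvt _ _ t0; rewrite g0 sub0r normrN sub0r.
  rewrite -[X in _ * X](ltr0_norm t0) -mulrA -exprSr; apply => x.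
  by rewrite in_itv/= => /andP[tx x0]; rewrite (ltr0_norm t0) ler0_norm// lerN2.
- have := mvt _ _ t0; rewrite g0 !subr0 => H; apply: le_trans (H _) _ => [x|].
    by rewrite in_itv/= => /andP[x0 xt]; rewrite (gtr0_norm t0) ger0_norm.
  by rewrite exprSr mulrA (gtr0_norm t0).
- by rewrite t0 g0 normr0 expr0n mulr0.
Qed.

(** * Taylor expansion with a uniform remainder *)

Section taylor.
Context {R : realType} {T : Type} (D : set T) (d : R).

(** By induction applied to the derivative: [poly_primitive] integrates its Taylor polynomial, and
    [norm_le_of_derive] its remainder, with the same [M]. *)
Lemma bounded_derivs_taylor m (f : T -> R -> R) : 0 < d ->
  bounded_derivs D d m f ->
  exists M, forall w, D w -> exists p : {poly R},
    [/\ (size p <= m)%N,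
        forall j, (j < m)%N -> p`_j * j`!%:R = derive1n j (f w) 0 &
        forall t : R, `|t| < d -> `|f w t - p.[t]| <= M * `|t| ^+ m].
Proof.
move=> d0; elim: m f => [|m IHm] f bf.
  have [M fM] := bounded_derivs_bounded bf; exists M => w Dw.
  exists 0; split => [|//|t td]; first by rewrite size_poly0.
  by rewrite horner0 subr0 expr0 mulr1 fM.
have df := bounded_derivs_is_derive bf.
have [_ [_ /IHm [M IH]]] := bf; exists M => w Dw.
have [p [sp pj pt]] := IH w Dw.
exists (poly_primitive p + (f w 0)%:P); split.
- rewrite (leq_trans (size_polyD _ _))// geq_max (leq_trans (size_poly _ _))//=.
  by rewrite (leq_trans (size_polyC_leq1 _)).
- case=> [_|j]; first by rewrite coefD coefC coef_poly/= invr0 mulr0 add0r mulr1.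
  rewrite ltnS => jm; rewrite derive1Sn -pj// coefD coefC coef_poly/= addr0 ltnS.
  rewrite factS natrM; case: ltnP => js; last by rewrite nth_default// !mul0r.
  by rewrite mulrA divfK.
move=> t td; apply: (norm_le_of_derive (d := d) (g := fun t => f w t - _)
  (g' := fun t => derive1 (f w) t - p.[t])) => //.
- rewrite hornerD hornerC; suff -> : (poly_primitive p).[0] = 0 by rewrite add0r subrr.
  by rewrite horner_coef0 coef_poly/= invr0 mulr0.
move=> s sd; apply: is_deriveB; first exact: df.
have -> : p.[s] = (poly_primitive p + (f w 0)%:P)^`().[s].
  by rewrite derivD derivC addr0 deriv_poly_primitive.
exact: is_derive_poly.
Qed.

End taylor.

(** * Differentiation under the integral sign *)

Section bounded_derivs_integral.
Context {R : realType} {T : Type} (D : set T) (d : R).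
Context d' (Y : measurableType d') (mu : {measure set Y -> \bar R}) (B : set Y).
Hypotheses (mB : measurable B) (Boo : (mu B < +oo)%E).

Lemma measurable_derive1 (f : Y -> R -> R) :
  (forall t : R, `|t| < d -> measurable_fun B (f ^~ t)) ->
  (forall y, B y -> forall t : R, `|t| < d -> derivable (f y) t 1) ->
  forall t : R, `|t| < d -> measurable_fun B (fun y => derive1 (f y) t).
Proof.
move=> mf df t td.
have e0 : 0 < d - `|t| by rewrite subr_gt0.
(* Difference quotients along this sequence converge to the derivative. The shift by 2 gives u j < d
   - |t| from j = 0 on, so that u j + t stays in the interval. *)
pose u (j : nat) : R := (d - `|t|) * j.+2%:R^-1.
have u0 j : u j != 0 by rewrite mulf_neq0 ?gt_eqF// invr_gt0.
have u_cvg : u j @[j --> \oo] --> (0 : R).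
  rewrite -[X in _ --> X](mulr0 (d - `|t|)); apply: cvgM; first exact: cvg_cst.
  have : (j.+1%:R^-1 : R) @[j --> \oo] --> (0 : R).
    apply/cvgrPdist_lt => e e0'; near=> j.
    rewrite sub0r normrN gtr0_norm ?invr_gt0//.
    by near: j; exact: near_infty_natSinv_lt (PosNum e0').
  by rewrite -(cvg_shiftS (fun j => j.+1%:R^-1 : R)).
have ud j : `|u j + t| < d.
  rewrite (le_lt_trans (ler_normD _ _))// gtr0_norm ?divr_gt0// -ltrBrDr.
  by rewrite /u gtr_pMr// invf_lt1// ltr1n.
apply: (@measurable_fun_cvg _ _ _ B (fun j y => (u j)^-1 * (f y (u j + t) - f y t))).
  move=> j; apply: measurable_funM; first exact: measurable_cst.
  by apply: measurable_funB; exact: mf.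
move=> y By; have := df y By t td; rewrite derive1E => dfy.
have /cvgr_dnbhsP/(_ u (conj u0 u_cvg)) := dfy.
by under eq_fun do rewrite /= [_ *: 1]mulr1.
Unshelve. all: by end_near. Qed.

Let section_integrable M (g : Y -> R) : measurable_fun B g ->
  (forall y, B y -> `|g y| <= M) -> mu.-integrable B (EFin \o g).
Proof. exact: bounded_integrable. Qed.

Let measurable_sections (f : T -> Y -> R -> R) := forall w, D w ->
  forall t : R, `|t| < d -> measurable_fun B (fun y => f w y t).

Let joint : set (T * Y) := [set p | D p.1 /\ B p.2].

Lemma unif_bounded_Rintegral (f : T -> Y -> R -> R) :
  measurable_sections f -> unif_bounded joint d (fun p => f p.1 p.2) ->
  unif_bounded D d (fun w t => \int[mu]_(y in B) f w y t).
Proof.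
move=> mf [M fM]; exists (`|M| * fine (mu B)) => w Dw t td.
have fwM y : B y -> `|f w y t| <= M by move=> By; exact: (fM (w, y)).
have fI := section_integrable (mf w Dw t td) fwM.
rewrite (le_trans (le_normr_Rintegral mB fI))// -Rintegral_cst//.
apply: le_Rintegral => //.
- apply: (section_integrable (M := M)).
    by apply: measurableT_comp => //; exact: mf.
  by move=> y By; rewrite normr_id fwM.
- by apply: (section_integrable (M := `|M|)) => // y _; rewrite normr_id.
- by move=> y By; rewrite (le_trans (fwM y By))// ler_norm.
Qed.

(** The uniform bound on the derivative is the integrable majorant, [B] having finite measure; the
    induction then applies to the derivative. *)
Lemma bounded_derivs_Rintegral m (f : T -> Y -> R -> R) :
  measurable_sections f -> bounded_derivs joint d m (fun p => f p.1 p.2) ->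
  bounded_derivs D d m (fun w t => \int[mu]_(y in B) f w y t).
Proof.
elim: m f => [|m IHm] f mf bf.
  by split => //; apply: unif_bounded_Rintegral => //; case: bf.
have [M fM] := bounded_derivs_bounded bf.
have [_ [df bf']] := bf.
have [M' fM'] := bounded_derivs_bounded bf'.
apply: (@bounded_derivsS _ _ _ _ _ _
  (fun w t => \int[mu]_(y in B) derive1 (f w y) t)).
- exact: unif_bounded_Rintegral mf (bounded_derivs_bounded bf).
- move=> w Dw t td.
  pose I : set R := `]-d, d[%classic.
  have IP x : I x <-> `|x| < d by rewrite /I/= in_itv/= -ltr_norml.
  have It : I t by exact/IP.
  have fI x : I x -> mu.-integrable B (EFin \o (fun y => f w y x)).
    move=> /IP xd; apply: (section_integrable (M := M)); first exact: mf.
    by move=> y By; exact: (fM (w, y)).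
  have dfI x y : I x -> B y -> derivable (f w y) x 1.
    by move=> /IP xd By; exact: (df (w, y)).
  have dfM x y : I x -> B y ->
      `|partial1of2 (fun t y => f w y t) x y| <= `|M'|.
    move=> /IP xd By.
    by rewrite (le_trans (fM' (w, y) _ x xd))// ler_norm.
  have MI : mu.-integrable B (EFin \o (fun=> `|M'|)).
    by apply: (section_integrable (M := `|M'|)) => // y _; rewrite normr_id.
  have M'0 (y : Y) : 0 <= (fun=> `|M'|) y by exact: normr_ge0.
  apply: DeriveDef; first exact: (derivable_under_integral mB It fI dfI M'0 MI dfM).
  rewrite -derive1E.
  exact: (differentiation_under_integral mB It fI dfI M'0 MI dfM).
apply: (IHm (fun w y => derive1 (f w y))) => // w Dw t td.
apply: measurable_derive1 => // [s sd|y By]; first exact: mf.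
exact: (df (w, y)).
Qed.

End bounded_derivs_integral.

(** * First-order expansion from continuous partial derivatives *)

Section partial_derivatives.
Context {R : realType} {n : nat}.
Implicit Types (f : 'rV[R]_n -> R) (x v : 'rV[R]_n).

Definition partial f (i : 'I_n) x : R := 'D_(delta_mx 0 i) f x.

Lemma is_derive_line f x v (s : R) : derivable f (x + s *: v) v ->
  is_derive s (1 : R) (fun s : R => f (x + s *: v)) ('D_v f (x + s *: v)).
Proof.
have E : (fun h : R => h^-1 *: (((fun s : R => f (x + s *: v)) \o shift s) (h *: (1 : R))
    - f (x + s *: v))) = (fun h => h^-1 *: ((f \o shift (x + s *: v)) (h *: v) - f (x + s *: v))).
  apply/funext => h /=; congr (_ *: (f _ - _)).
  by rewrite [_ *: 1]mulr1 scalerDl addrCA addrA [_ + x]addrC.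
by move=> df; apply: DeriveDef; rewrite /derivable /derive E.
Qed.

Lemma norm_row_lt x (e : R) : 0 < e -> (`|x| < e) = [forall i, `|x 0 i| < e].
Proof.
move=> e0; apply/idP/forallP => [xe i|xe].
  by apply: le_lt_trans xe; rewrite /Num.norm/= mx_normrE (le_bigmax _ _ (0, i)).
rewrite /Num.norm/= mx_normrE; apply: bigmax_lt => // -[a i] _ /=.
by rewrite ord1.
Qed.

Lemma coord_le_norm x i : `|x 0 i| <= `|x|.
Proof. by rewrite [leRHS]/Num.norm/= mx_normrE (le_bigmax _ _ (0, i)). Qed.

(* Telescoping along the coordinates, with the mean value theorem at each step. *)
Lemma partials_continuous_approx f x :
  (forall i, \forall y \near x, derivable f y (delta_mx 0 i)) ->
  (forall i, {for x, continuous (partial f i)}) ->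
  forall e, 0 < e -> exists2 d, 0 < d & forall h, `|h| < d ->
    `|f (x + h) - f x - \sum_i h 0 i * partial f i x| <= e * `|h|.
Proof.
(* One share of the error per coordinate; [n.+1] because [n] may be 0. *)
move=> df cf e e0; pose e' := e / n.+1%:R.
have e'0 : 0 < e' by rewrite divr_gt0.
have : \forall y \near x, forall i, derivable f y (delta_mx 0 i) /\
    `|partial f i y - partial f i x| <= e'.
  apply: (@filter_forall _ _ _ _ (nbhs_filter x)) => i; apply: filterS2 (df i) _;
    first by move=> y dy; exact: (conj dy).
  by have /cvgr_distC_le := cf i; exact.
move=> /nbhs_ballP[d /= d0 xd]; exists d => // h hd.
pose p (j : nat) : 'rV[R]_n := \row_i (if (i < j)%N then h 0 i else 0).
have p0 : p 0%N = 0 by apply/rowP => i; rewrite !mxE.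
have pn : p n = h by apply/rowP => i; rewrite !mxE ltn_ord.
have pS (j : 'I_n) : p j.+1 = p j + h 0 j *: delta_mx 0 j.
  apply/rowP => i; rewrite !mxE ltnS eqxx/=.
  have [ij|ij|/val_inj ->] := ltngtP i j.
  - by rewrite -val_eqE/= ltn_eqF// mulr0 addr0.
  - by rewrite -val_eqE/= gtn_eqF// mulr0 addr0.
  - by rewrite eqxx mulr1 add0r.
have pd (j : 'I_n) (s : R) : `|s| < d -> ball x d (x + p j + s *: delta_mx 0 j).
  move=> sd; rewrite -ball_normE/= -(addrA x) opprD addrA subrr add0r normrN.
  rewrite norm_row_lt//; apply/forallP => i; rewrite !mxE eqxx/=.
  have [ij|ij|/val_inj ->] := ltngtP i j.
  - rewrite -val_eqE/= ltn_eqF// mulr0 addr0.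
    by apply: le_lt_trans hd; exact: coord_le_norm.
  - by rewrite -val_eqE/= gtn_eqF// mulr0 addr0 normr0.
  - by rewrite eqxx mulr1 add0r.
have step (j : 'I_n) : `|f (x + p j.+1) - f (x + p j) - h 0 j * partial f j x| <= e' * `|h|.
  pose g (s : R) := f (x + p j + s *: delta_mx 0 j) - (f (x + p j) + s * partial f j x).
  have := @norm_le_of_derive R d e' 0 g
    (fun s => partial f j (x + p j + s *: delta_mx 0 j) - partial f j x).
  rewrite /g scale0r addr0 mul0r addr0 subrr => /(_ erefl) H.
  have := H _ _ (h 0 j); rewrite expr1 pS addrA opprD addrA => {}H.
  apply: le_trans (H _ _ _) _.
  - move=> s sd; apply: is_deriveB.
      by apply: is_derive_line; have [] := xd _ (pd j _ sd) j.
    have -> : (fun s : R => f (x + p j) + s * partial f j x) =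
        horner (partial f j x *: 'X + (f (x + p j))%:P).
      by apply/funext => r; rewrite !hornerE addrC mulrC.
    by apply: is_derive_eq; rewrite derivD derivC addr0 derivZ derivX hornerZ hornerC mulr1.
  - by move=> s sd; rewrite expr0 mulr1; have [] := xd _ (pd j _ sd) j.
  - by apply: le_lt_trans hd; exact: coord_le_norm.
  - by rewrite ler_wpM2l// ?coord_le_norm// ltW.
rewrite -{1}pn -[X in _ - f X - _](addr0 x) -p0.
rewrite (_ : f (x + p n) - f (x + p 0%N) = \sum_(j < n) (f (x + p j.+1) - f (x + p j))); last first.
  by rewrite -(big_mkord predT (fun j => f (x + p j.+1) - f (x + p j))) telescope_sumr.
rewrite -sumrB; apply: le_trans (ler_norm_sum _ _ _) _.
apply: (@le_trans _ _ (\sum_(j < n) e' * `|h|)); first by apply: ler_sum => j _; exact: step.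
have n1 : n.+1%:R^-1 * n%:R <= 1 :> R by rewrite mulrC ler_pdivrMr// mul1r ler_nat.
rewrite sumr_const card_ord -mulrnAl ler_wpM2r//.
by rewrite /e' -mulr_natr -mulrA ler_piMr// ltW.
Qed.

End partial_derivatives.

(** * The boundary of a convex body in half-planes: elementary estimates *)

Section radial_function.
Context {R : realType} {n : nat}.
Variables (K : set 'rV[R]_n) (r0 M : R).
Hypotheses (Kclosed : closed K)
  (Kconvex : forall x y a, K x -> K y -> 0 <= a -> a <= 1 -> K (a *: x + (1 - a) *: y))
  (r0_gt0 : 0 < r0) (ball_sub_K : forall x, dotv x x <= r0 ^+ 2 -> K x)
  (M_gt0 : 0 < M) (K_sub_ball : forall x, K x -> dotv x x <= M ^+ 2).

(* A pair (xi, v) encodes the section function in the direction xi, restricted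
   to the half-plane spanned by the line R xi and the ray R_+ v. *)
Definition frame : set ('rV[R]_n * 'rV[R]_n) :=
  [set w | [/\ dotv w.1 w.1 = 1, dotv w.1 w.2 = 0, 1 <= dotv w.2 w.2 & dotv w.2 w.2 <= 4]].

Definition half_plane_point (w : 'rV[R]_n * 'rV[R]_n) (t r : R) : 'rV[R]_n :=
  t *: w.1 + r *: w.2.

Definition radius (w : 'rV[R]_n * 'rV[R]_n) (t : R) : R :=
  sup [set r | 0 <= r /\ K (half_plane_point w t r)].

Definition boundary_point w t := half_plane_point w t (radius w t).

(** For |t| < d, the axis points at heights r0 and -r0 are at distance at least d from height t, and
    the one at height 2t is still in [K]: the convexity arguments draw on these points. *)
Local Notation d := (r0 / 2).

Lemma dotv_half_plane_point w t r : frame w ->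
  dotv (half_plane_point w t r) (half_plane_point w t r) =
  t ^+ 2 + r ^+ 2 * dotv w.2 w.2.
Proof.
case=> w1 w12 _ _; rewrite dotvDl !dotvDr !dotvZl !dotvZr w1 (dotvC w.2) w12.
ring.
Qed.

Lemma le_radius_bound w t r : frame w -> 0 <= r ->
  K (half_plane_point w t r) -> r <= M.
Proof.
move=> fw r_ge0 /K_sub_ball; rewrite dotv_half_plane_point// => H.
have [_ _ v1 _] := fw.
rewrite -(ler_pXn2r (n := 2)) ?nnegrE ?(ltW M_gt0)//; apply: le_trans H.
by rewrite ler_wpDl ?sqr_ge0// ler_peMr ?sqr_ge0.
Qed.

Lemma d_lt_r0 (t : R) : `|t| < d -> `|t| < r0.
Proof. by move=> td; apply: lt_trans td _; rewrite ltr_pdivrMr// ltr_pMr// ltr1n. Qed.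

Lemma K_half_plane_axis w t : frame w -> `|t| <= r0 -> K (t *: w.1).
Proof.
move=> [w1 _ _ _] td; apply: ball_sub_K; rewrite dotvZl dotvZr w1 mulr1 -expr2.
by rewrite -real_normK ?num_real// lerXn2r ?nnegrE// ltW.
Qed.

Lemma radius_set_neq0 w t : frame w -> `|t| < d ->
  [set r | 0 <= r /\ K (half_plane_point w t r)] !=set0.
Proof.
move=> fw td; exists 0; split => //; rewrite /half_plane_point scale0r addr0.
by apply: K_half_plane_axis => //; rewrite ltW// d_lt_r0.
Qed.

Lemma radius_set_ubound w t : frame w ->
  has_ubound [set r | 0 <= r /\ K (half_plane_point w t r)].
Proof. by move=> fw; exists M => r [r_ge0 Kr]; exact: (@le_radius_bound w t). Qed.

Lemma radius_max w t r : frame w -> 0 <= r ->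
  K (half_plane_point w t r) -> r <= radius w t.
Proof. by move=> fw r_ge0 Kr; apply: ub_le_sup; [exact: radius_set_ubound|]. Qed.

Lemma boundary_point_in w t : frame w -> `|t| < d -> K (boundary_point w t).
Proof.
move=> fw td.
suff [] : [set r | 0 <= r /\ K (half_plane_point w t r)] (radius w t) by [].
have cl : closed [set r | 0 <= r /\ K (half_plane_point w t r)].
  apply: closedI; first exact: closed_ge.
  apply: (@closed_comp _ _ (half_plane_point w t)) => // r _.
  apply: cvgD; first exact: cvg_cst.
  by apply: cvgZl; exact: cvg_id.
apply: cl; apply: closure_sup; [exact: radius_set_neq0|exact: radius_set_ubound].
Qed.

(** Since |w.2|^2 <= 4, the point has squared norm at most r0^2 / 4 + 4 (r0 / 4)^2 = r0^2 / 2. *)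
Lemma radius_ge w t : frame w -> `|t| < d -> r0 / 4 <= radius w t.
Proof.
move=> fw td; apply: radius_max => //; first by rewrite divr_ge0 ?ltW.
apply: ball_sub_K; rewrite dotv_half_plane_point//.
have [_ _ _ v4] := fw.
have t2 : t ^+ 2 <= d ^+ 2.
  have d0 : 0 <= d by rewrite divr_ge0 // ltW.
  by rewrite -real_normK ?num_real// lerXn2r ?nnegrE// ltW.
have : (r0 / 4) ^+ 2 * dotv w.2 w.2 <= (r0 / 4) ^+ 2 * 4 by rewrite ler_wpM2l ?sqr_ge0.
move: t2; move: (dotv _ _) (t ^+ 2) => a b; have := sqr_ge0 r0; nra.
Qed.

Lemma radius_gt0 w t : frame w -> `|t| < d -> 0 < radius w t.
Proof. by move=> fw td; apply: lt_le_trans (radius_ge fw td); rewrite divr_gt0. Qed.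

Lemma radius_le w t : frame w -> `|t| < d -> radius w t <= M.
Proof.
move=> fw td; apply: (@le_radius_bound w t) => //; first by rewrite ltW// radius_gt0.
exact: boundary_point_in.
Qed.

(** A point below the boundary point is a convex combination of it and of the axis point [t *: w.1].
    This gives the star-shapedness that polar coordinates require. *)
Lemma half_plane_point_in w t r : frame w -> `|t| < d -> 0 <= r ->
  K (half_plane_point w t r) <-> r <= radius w t.
Proof.
move=> fw td r_ge0; split; first exact: radius_max.
move=> rr; have r0' := radius_gt0 fw td.
have -> : half_plane_point w t r =
    (r / radius w t) *: boundary_point w t + (1 - r / radius w t) *: (t *: w.1).
  rewrite /boundary_point /half_plane_point scalerDr addrAC -scalerDl.
  rewrite (_ : r / radius w t + (1 - r / radius w t) = 1); last by ring.
  by rewrite scale1r scalerA divfK ?gt_eqF.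
apply: Kconvex; first exact: boundary_point_in.
- by apply: K_half_plane_axis => //; rewrite ltW// d_lt_r0.
- by rewrite divr_ge0// ltW.
- by rewrite ler_pdivrMr// mul1r.
Qed.

(** A concave function with values in [0, M]. The estimate turns errors small against the
    displacement of the boundary point into errors small against s, before [radius] is known to be
    derivable. *)
Lemma radius_lipschitz w t s : frame w -> `|t| < d -> `|s| < d ->
  `|radius w s - radius w t| <= M / d * `|s - t|.
Proof.
move=> fw.
have half (t' s' : R) : `|t'| < d -> `|s'| < d ->
    radius w t' - radius w s' <= M / d * `|s' - t'|.
  move=> td sd.
  (* From t' towards the endpoint e = r0 or -r0 beyond s', the radius loses at most the fraction l =
     (s' - t') / (e - t') of its value, and l <= |s' - t'| / d. *)
  have key (e : R) : `|e| = r0 -> 0 <= (s' - t') / (e - t') -> (s' - t') / (e - t') <= 1 ->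
      d <= `|e - t'| -> radius w t' - radius w s' <= M / d * `|s' - t'|.
    move=> er; set l := _ / _ => l0 l1 de.
    have et : e - t' != 0 by rewrite -normr_gt0 (lt_le_trans _ de)// divr_gt0.
    have : (1 - l) * radius w t' <= radius w s'.
      apply: radius_max => //; first by rewrite mulr_ge0 ?subr_ge0// ltW// radius_gt0.
      have -> : half_plane_point w s' ((1 - l) * radius w t') =
          l *: (e *: w.1) + (1 - l) *: boundary_point w t'.
        rewrite /boundary_point /half_plane_point [in RHS]scalerDr addrA !scalerA -scalerDl.
        by congr (_ *: _ + _); rewrite /l; field.
      by apply: Kconvex => //; [apply: K_half_plane_axis; rewrite ?er|exact: boundary_point_in].
    have lE : l <= `|s' - t'| / d.
      rewrite -(ger0_norm l0) normrM normfV ler_wpM2l// lef_pV2// posrE ?divr_gt0//.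
      by rewrite normr_gt0.
    have := radius_le fw td; have := radius_gt0 fw td.
    move: (radius w t') (radius w s') => a b a0 aM ab.
    apply: (@le_trans _ _ (l * a)); first by rewrite mulrBl mul1r in ab; lra.
    rewrite (_ : M / d * _ = `|s' - t'| / d * M); last by rewrite [RHS]mulrC mulrA mulrAC.
    by rewrite ler_pM// ltW.
  have := td; have := sd; rewrite !ltr_norml => /andP[s1 s2] /andP[t1 t2].
  have [st|st] := leP t' s'.
    have e0 : 0 < r0 - t' by lra.
    apply: (key r0); first exact: gtr0_norm.
    - by apply: divr_ge0; lra.
    - by rewrite ler_pdivrMr// mul1r; lra.
    - by rewrite gtr0_norm//; lra.
  have e0 : 0 < r0 + t' by lra.
  apply: (key (- r0)); first by rewrite normrN gtr0_norm.
  - by rewrite -opprB -opprD invrN mulrNN; apply: divr_ge0; lra.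
  - by rewrite -opprB -opprD invrN mulrNN ler_pdivrMr// mul1r; lra.
  - by rewrite -opprD normrN gtr0_norm//; lra.
move=> td sd; rewrite ler_norml; apply/andP; split; last first.
  by rewrite distrC; exact: half.
by rewrite lerNl opprB; exact: half.
Qed.

End radial_function.

Lemma is_derive_approx {R : realType} (phi : R -> R) (t L : R) :
  is_derive t (1 : R) phi L <->
  forall e, 0 < e -> exists2 d, 0 < d &
    forall s, `|s| < d -> `|phi (t + s) - phi t - s * L| <= e * `|s|.
Proof.
have E : (fun h : R => h^-1 *: ((phi \o shift t) (h *: (1 : R)) - phi t)) =
    (fun h => h^-1 * (phi (t + h) - phi t)).
  by apply/funext => h /=; congr (_ * (phi _ - _)); rewrite [_ *: 1]mulr1 addrC.
split=> [[dphi dE] e e0|H].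
  have : h^-1 * (phi (t + h) - phi t) @[h --> 0^'] --> L.
    by rewrite -dE /derive E; move: dphi; rewrite /derivable E.
  move=> /cvgrPdist_le/(_ _ e0); rewrite /dnbhs/= /within/= => /nbhs_ballP[d /= d0 dH].
  exists d => // s sd; have [->|s0] := eqVneq s 0.
    by rewrite addr0 subrr mul0r subr0 !normr0 mulr0.
  have /= := dH s; rewrite -ball_normE/= sub0r normrN => /(_ sd s0).
  rewrite distrC -(ler_pM2r (x := `|s|)) ?normr_gt0// -normrM mulrBl.
  by rewrite mulrAC mulVf// mul1r (mulrC L).
have cvgL : h^-1 * (phi (t + h) - phi t) @[h --> 0^'] --> L.
  apply/cvgrPdist_le => e e0; have [d d0 dH] := H e e0.
  rewrite /dnbhs/= /within/=; apply/nbhs_ballP; exists d => //= s.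
  rewrite -ball_normE/= sub0r normrN => sd s0.
  rewrite distrC -(ler_pM2r (x := `|s|)) ?normr_gt0// -normrM mulrBl.
  by rewrite mulrAC mulVf// mul1r (mulrC L); exact: dH.
apply: DeriveDef; first by rewrite /derivable E; apply/cvg_ex; exists L.
by rewrite /derive E; exact: cvg_lim.
Qed.

(** * Smooth functions away from the origin *)

Section smooth_off_origin.
Context {R : realType} {n : nat}.
Implicit Types (f : 'rV[R]_n -> R) (x v : 'rV[R]_n).

Definition smooth_off0 f := forall k, continuously_diff k [set x | x != 0] f.

(** The differential, written with partial derivatives so that it is linear in [v] by
    construction. *)
Definition dirder f v x := \sum_i v 0 i * partial f i x.

Lemma dirderD f v v' x : dirder f (v + v') x = dirder f v x + dirder f v' x.
Proof. by rewrite /dirder -big_split; apply: eq_bigr => i _; rewrite mxE mulrDl. Qed.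

Lemma dirderZ f (a : R) v x : dirder f (a *: v) x = a * dirder f v x.
Proof. by rewrite /dirder big_distrr/=; apply: eq_bigr => i _; rewrite mxE mulrA. Qed.

Lemma smooth_off0_continuous f x : smooth_off0 f -> x != 0 -> {for x, continuous f}.
Proof. by move=> /(_ 0%N)[fc _]; exact: fc. Qed.

Lemma smooth_off0_partial f i : smooth_off0 f -> smooth_off0 (partial f i).
Proof. by move=> fs k; have [_ /(_ i)[_]] := fs k.+1. Qed.

Lemma near_neq0 x : x != 0 -> \forall y \near x, y != 0.
Proof.
move=> x0; have : open [set y : 'rV[R]_n | y != 0].
  rewrite (_ : mkset _ = ~` [set 0]); last by apply/seteqP; split => y /= /eqP.
  by apply: closed_openC; apply: accessible_closed_set1;
     apply: hausdorff_accessible; exact: norm_hausdorff.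
by move=> oU; exact: (open_nbhs_nbhs (conj oU x0)).
Qed.

Lemma smooth_off0_approx f x : smooth_off0 f -> x != 0 ->
  forall e, 0 < e -> exists2 d, 0 < d & forall h, `|h| < d ->
    `|f (x + h) - f x - dirder f h x| <= e * `|h|.
Proof.
move=> fs x0; apply: partials_continuous_approx => i.
  apply: filterS (near_neq0 x0) => y y0.
  by have [_ /(_ i)[fd _]] := fs 1%N; exact: fd.
exact: smooth_off0_continuous (smooth_off0_partial i fs) x0.
Qed.

End smooth_off_origin.

(** * Smoothness of the radius by implicit differentiation *)

Section smooth_radius.
Context {R : realType} {n : nat}.
Variables (K : set 'rV[R]_n) (r0 M : R).
Hypotheses (Kclosed : closed K)
  (Kconvex : forall x y a, K x -> K y -> 0 <= a -> a <= 1 -> K (a *: x + (1 - a) *: y))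
  (r0_gt0 : 0 < r0) (ball_sub_K : forall x, dotv x x <= r0 ^+ 2 -> K x)
  (M_gt0 : 0 < M) (K_sub_ball : forall x, K x -> dotv x x <= M ^+ 2).
Local Notation g := (minkowski_functional K).
Hypothesis gsmooth : smooth_off0 g.

Local Notation d := (r0 / 2).
Local Notation bp := (boundary_point K).
Local Notation rho := (radius K).
Let rho_gt0 := radius_gt0 r0_gt0 ball_sub_K M_gt0 K_sub_ball.
Let rho_ge := radius_ge r0_gt0 ball_sub_K M_gt0 K_sub_ball.
Let rho_le := radius_le Kclosed r0_gt0 ball_sub_K M_gt0 K_sub_ball.
Let rho_max := radius_max M_gt0 K_sub_ball.
Let rho_lip := radius_lipschitz Kclosed Kconvex r0_gt0 ball_sub_K M_gt0 K_sub_ball.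
Let bp_in := boundary_point_in Kclosed r0_gt0 ball_sub_K M_gt0 K_sub_ball.

Lemma minkowski_le y a : K y -> 0 <= a -> g (a *: y) <= a.
Proof.
move=> Ky a0; apply: ge_inf; first by exists 0 => b [].
by split => //; exists y.
Qed.

(** If the boundary point were a y with y in [K] and a < 1, adding (1 - a) d w.2 would keep it in
    [K], against the maximality of the radius. Here d w.2 lies in [K] because |w.2| <= 2. *)
Lemma minkowski_boundary_point w t : frame w -> `|t| < d -> g (bp w t) = 1.
Proof.
move=> fw td; have Kx := bp_in fw td.
apply/eqP; rewrite eq_le; apply/andP; split.
  by rewrite -[bp w t]scale1r; exact: minkowski_le.
apply: lb_le_inf; first by exists 1; split => //; exists (bp w t) => //; rewrite scale1r.
move=> a [a0 [y Ky yE]]; rewrite leNgt; apply/negP => a1.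
have [_ _ _ v4] := fw.
have d0 : 0 < d by rewrite divr_gt0.
have Kv : K (d *: w.2).
  apply: ball_sub_K; rewrite dotvZl dotvZr mulrA -expr2.
  apply: (@le_trans _ _ (d ^+ 2 * 4)); first by rewrite ler_wpM2l ?sqr_ge0.
  by rewrite (_ : d ^+ 2 * 4 = r0 ^+ 2)//; field.
have : rho w t + (1 - a) * d <= rho w t.
  apply: rho_max => //.
    apply: addr_ge0; first by rewrite ltW// rho_gt0.
    by apply: mulr_ge0; [rewrite subr_ge0|]; exact: ltW.
  have -> : half_plane_point w t (rho w t + (1 - a) * d) = a *: y + (1 - a) *: (d *: w.2).
    by rewrite yE scalerA /boundary_point /half_plane_point -addrA -scalerDl.
  by apply: Kconvex => //; exact: ltW.
by apply/negP; rewrite -ltNge ltrDl mulr_gt0// subr_gt0.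
Qed.

Lemma dotv_boundary_point_ge w t : frame w -> `|t| < d ->
  (r0 / 4) ^+ 2 <= dotv (bp w t) (bp w t).
Proof.
move=> fw td; rewrite dotv_half_plane_point//; have [_ _ v1 _] := fw.
have r4 : 0 <= r0 / 4 by rewrite divr_ge0// ltW.
apply: (@le_trans _ _ (rho w t ^+ 2)).
  by rewrite lerXn2r ?nnegrE// ?rho_ge// ltW// rho_gt0.
by rewrite ler_wpDl ?sqr_ge0// ler_peMr ?sqr_ge0.
Qed.

Lemma boundary_point_neq0 w t : frame w -> `|t| < d -> bp w t != 0.
Proof.
move=> fw td; rewrite -dotv_gt0 (lt_le_trans _ (dotv_boundary_point_ge fw td))//.
by rewrite exprn_gt0// divr_gt0.
Qed.

(* Convexity: the segment from the boundary point back to the axis point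
   [t *: w.1], where g <= 1/2, bounds the radial derivative from below. *)
Lemma radial_derivative_ge w t : frame w -> `|t| < d ->
  (M + M)^-1 <= dirder g w.2 (bp w t).
Proof.
move=> fw td; have r := rho_gt0 fw td.
apply: (@le_trans _ _ (rho w t + rho w t)^-1).
  by rewrite lef_pV2 ?posrE ?addr_gt0// lerD// rho_le.
set x := bp w t; set L := dirder g w.2 x.
suff H e : 0 < e -> (rho w t + rho w t)^-1 <= L + e.
  by apply/ler_addgt0Pr => e e0; exact: H.
move=> e0.
have [v1 v4] : 1 <= dotv w.2 w.2 /\ dotv w.2 w.2 <= 4 by have [] := fw.
have v0 : w.2 != 0 by rewrite -dotv_gt0 (lt_le_trans ltr01).
have nv : 0 < `|w.2| by rewrite normr_gt0.
have [eta eta0 H] := smooth_off0_approx gsmooth (boundary_point_neq0 fw td) (divr_gt0 e0 nv).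
(* The first term keeps the displacement within reach of the expansion, the second gives q <= 1/2
   below. *)
pose s := Num.min (eta / 2 / `|w.2|) (rho w t).
have s0 : 0 < s by rewrite /s lt_min r !divr_gt0.
have sr : s <= rho w t by rewrite /s ge_min lexx orbT.
have sv : `|- s *: w.2| < eta.
  rewrite normrZ normrN gtr0_norm// -ltr_pdivlMr//.
  by rewrite /s gt_min ltr_pM2r ?invr_gt0// gtr_pMr// invf_lt1// ltr1n.
have := H _ sv; rewrite minkowski_boundary_point// -/x dirderZ -/L normrZ normrN (gtr0_norm s0).
rewrite (mulrCA (e / _)) divfK ?gt_eqF// mulNr opprK.
(* With q = s / (2 rho), the point is (1 - q) times a convex combination of [x] and
   [(2 * t) *: w.1], both in [K]; so g has dropped by at least q. *)
have gle : g (x + - s *: w.2) <= 1 - s / (rho w t + rho w t).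
  set q := s / (rho w t + rho w t).
  have q0 : 0 < q by rewrite divr_gt0// addr_gt0.
  have q1 : q <= 1 / 2 by rewrite /q ler_pdivrMr ?addr_gt0//; lra.
  have q1' : 0 < 1 - q by lra.
  have sE : s = q * (rho w t + rho w t) by rewrite divfK// gt_eqF// addr_gt0.
  pose c := (1 - q - q) / (1 - q).
  have -> : x + - s *: w.2 = (1 - q) *: (c *: x + (1 - c) *: ((2 * t) *: w.1)).
    apply/rowP => i; rewrite /x /boundary_point /half_plane_point !mxE sE /c.
    by field; rewrite gt_eqF.
  apply: minkowski_le; last exact: ltW.
  apply: Kconvex; first exact: bp_in.
  - apply: (K_half_plane_axis r0_gt0 ball_sub_K fw).
    rewrite normrM gtr0_norm// mulrC -ler_pdivlMr//; exact: ltW.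
  - by apply: divr_ge0; lra.
  - by rewrite ler_pdivrMr// mul1r; lra.
move=> /ler_normlP[Hg _].
have : s / (rho w t + rho w t) <= s * L + s * e by lra.
by rewrite -mulrDr ler_pM2l.
Qed.

(** A Lipschitz constant of the boundary point, from [radius_lipschitz]; the summand 1 keeps it
    positive for the divisions. *)
Let speed (w : 'rV[R]_n * 'rV[R]_n) : R := `|w.1| + M / d * `|w.2| + 1.

Let speed_gt0 w : 0 < speed w.
Proof.
by rewrite /speed ltr_wpDl// addr_ge0// mulr_ge0// divr_ge0 ?divr_ge0 ?(ltW M_gt0) ?(ltW r0_gt0).
Qed.

Let boundary_increment w t s : bp w (t + s) =
  bp w t + (s *: w.1 + (rho w (t + s) - rho w t) *: w.2).
Proof.
rewrite /boundary_point /half_plane_point scalerDl scalerBl.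
by rewrite addrACA; congr (_ + _); rewrite addrC subrK.
Qed.

Let boundary_increment_le w t s : frame w -> `|t| < d -> `|t + s| < d ->
  `|s *: w.1 + (rho w (t + s) - rho w t) *: w.2| <= speed w * `|s|.
Proof.
move=> fw td tsd; apply: le_trans (ler_normD _ _) _; rewrite !normrZ.
have := rho_lip fw td tsd; rewrite (addrC t) addrK => lip.
rewrite /speed !mulrDl mul1r; apply: (@le_trans _ _ (`|w.1| * `|s| + M / d * `|w.2| * `|s|)).
  by rewrite lerD// ?(mulrC `|s|)// mulrAC ler_wpM2r.
by rewrite lerDl.
Qed.

(** The increment of [rho] is left unexpanded: taking for [f] the Minkowski functional, which is
    constant along the boundary, one can then solve for it. *)
Lemma boundary_point_approx f w t : smooth_off0 f -> frame w -> `|t| < d ->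
  forall e, 0 < e -> exists2 eta, 0 < eta & forall s : R, `|s| < eta ->
    `|t + s| < d /\
    `|f (bp w (t + s)) - f (bp w t) - (s * dirder f w.1 (bp w t) +
        (rho w (t + s) - rho w t) * dirder f w.2 (bp w t))| <= e * `|s|.
Proof.
move=> fs fw td e e0.
have [eta eta0 H] := smooth_off0_approx fs (boundary_point_neq0 fw td) (divr_gt0 e0 (speed_gt0 w)).
have dt : 0 < d - `|t| by rewrite subr_gt0.
exists (Num.min (d - `|t|) (eta / speed w)).
  by rewrite lt_min dt divr_gt0 ?speed_gt0.
move=> s; rewrite lt_min => /andP[sd seta].
have tsd : `|t + s| < d by rewrite (le_lt_trans (ler_normD _ _))// addrC -ltrBrDr.
split => //; have hle := boundary_increment_le fw td tsd.
rewrite boundary_increment -!dirderZ -dirderD; apply: le_trans (H _ _) _.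
  by apply: le_lt_trans hle _; rewrite mulrC -ltr_pdivlMr ?speed_gt0.
apply: (@le_trans _ _ (e / speed w * (speed w * `|s|))).
  by rewrite ler_wpM2l// divr_ge0// ltW// speed_gt0.
by rewrite mulrA divfK// gt_eqF// speed_gt0.
Qed.

(** The solution rho' of dg(w.1) + rho' dg(w.2) = 0, which is g = 1 differentiated along the
    boundary. *)
Definition radius_slope w t := - (dirder g w.1 (bp w t) * (dirder g w.2 (bp w t))^-1).

Lemma radial_derivative_gt0 w t : frame w -> `|t| < d -> 0 < dirder g w.2 (bp w t).
Proof.
move=> fw td; apply: lt_le_trans (radial_derivative_ge fw td).
by rewrite invr_gt0 addr_gt0.
Qed.

Lemma is_derive_radius w t : frame w -> `|t| < d ->
  is_derive t (1 : R) (rho w) (radius_slope w t).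
Proof.
move=> fw td; apply/is_derive_approx => e e0.
have L0 := radial_derivative_gt0 fw td.
have [eta eta0 H] := boundary_point_approx gsmooth fw td (mulr_gt0 e0 L0).
exists eta => // s /H[tsd]; rewrite !minkowski_boundary_point// subrr sub0r normrN => Hs.
rewrite -(ler_pM2r L0) mulrAC -[X in _ * X <= _](gtr0_norm L0) -normrM.
apply: le_trans Hs; rewrite le_eqVlt; apply/orP; left; apply/eqP; congr `|_|.
by rewrite /radius_slope; field; rewrite gt_eqF.
Qed.

Lemma is_derive_boundary f w t : smooth_off0 f -> frame w -> `|t| < d ->
  is_derive t (1 : R) (fun t => f (bp w t))
    (dirder f w.1 (bp w t) + radius_slope w t * dirder f w.2 (bp w t)).
Proof.
move=> fs fw td; apply/is_derive_approx => e e0.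
have e20 : 0 < e / 2 by rewrite divr_gt0.
set L := dirder f w.2 _.
have L0 : 0 < `|L| + 1 by rewrite ltr_wpDl.
have [eta1 eta10 H1] := boundary_point_approx fs fw td e20.
have [eta2 eta20 H2] := (is_derive_approx _ _ _).1 (is_derive_radius fw td) _ (divr_gt0 e20 L0).
exists (Num.min eta1 eta2); first by rewrite lt_min eta10.
move=> s; rewrite lt_min => /andP[/H1[tsd {}H1] /H2{}H2].
have -> : f (bp w (t + s)) - f (bp w t) - s * (dirder f w.1 (bp w t) + radius_slope w t * L) =
  (f (bp w (t + s)) - f (bp w t) - (s * dirder f w.1 (bp w t) + (rho w (t + s) - rho w t) * L)) +
  (rho w (t + s) - rho w t - s * radius_slope w t) * L by ring.
apply: le_trans (ler_normD _ _) _.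
rewrite [leRHS](_ : _ = e / 2 * `|s| + e / 2 * `|s|); last by rewrite -mulrDl -splitr.
apply: lerD; first exact: H1.
rewrite normrM.
apply: (@le_trans _ _ (e / 2 / (`|L| + 1) * `|s| * (`|L| + 1))).
  by rewrite ler_pM// lerDl.
by rewrite mulrAC divfK// gt_eqF.
Qed.

Hypothesis Kcompact : compact K.

(** All boundary points lie in one compact set that avoids the origin, where [f] is continuous. *)
Lemma unif_bounded_boundary f : smooth_off0 f ->
  unif_bounded frame d (fun w t => f (bp w t)).
Proof.
move=> fs; pose C := K `&` [set x | (r0 / 4) ^+ 2 <= dotv x x].
have Cc : compact C.
  apply: compact_closedI => //.
  apply: (@closed_comp _ _ (fun x : 'rV[R]_n => dotv x x) [set r | (r0 / 4) ^+ 2 <= r]) => [x _|].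
    apply: (@cvg_big _ _ _ _ _ (@add_continuous R) _ (nbhs x) _ _ _ (nbhs_filter x)) => i _.
    by apply: cvgM; exact: coord_continuous.
  exact: closed_ge.
have C0 x : C x -> x != 0.
  move=> [_ xC]; rewrite -dotv_gt0 (lt_le_trans _ xC)//.
  by rewrite exprn_gt0// divr_gt0.
have fc : {within C, continuous f}.
  apply: continuous_in_subspaceT => x /set_mem Cx.
  exact: smooth_off0_continuous fs (C0 _ Cx).
have [N [_ HN]] := compact_bounded (continuous_compact fc Cc).
exists (N + 1) => w fw t td; apply: (HN (N + 1)); first by rewrite ltrDl.
exists (bp w t) => //; split; first exact: bp_in.
exact: dotv_boundary_point_ge.
Qed.

(** A joint induction: the derivative of [rho] is a quotient of functions of the boundary point, and
    that of [f] along the boundary involves the derivative of [rho]. Quantifying over [f] makes the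
    partial derivatives available at each order. *)
Lemma bounded_derivs_boundary m :
  (forall f, smooth_off0 f -> bounded_derivs frame d m (fun w t => f (bp w t))) /\
  bounded_derivs frame d m rho.
Proof.
have rho_bounded : unif_bounded frame d rho.
  by exists M => w fw t td; rewrite gtr0_norm ?rho_gt0// rho_le.
elim: m => [|m [IHf IHr]].
  by split => [f fs|]; split => //; exact: unif_bounded_boundary.
have bcoord (w : 'rV[R]_n * 'rV[R]_n) i : frame w -> `|w.1 0 i| <= 2 /\ `|w.2 0 i| <= 2.
  move=> [w1 _ _ v4]; have b2 (u : 'rV[R]_n) : dotv u u <= 4 -> `|u 0 i| <= 2.
    move=> u4; rewrite -(ler_pXn2r (n := 2)) ?nnegrE// real_normK ?num_real//.
    by rewrite (le_trans (coord_sqr_le_dotv _ _))// (le_trans u4)// -natrX ler_nat.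
  by split; apply: b2; rewrite ?w1// ler1n.
have bdir f : smooth_off0 f ->
    bounded_derivs frame d m (fun w t => dirder f w.1 (bp w t)) /\
    bounded_derivs frame d m (fun w t => dirder f w.2 (bp w t)).
  have c1 (i : 'I_n) : bounded_derivs (@frame R n) d m (fun w _ => w.1 0 i).
    apply: (@bounded_derivs_cst R _ frame d m (fun w => w.1 0 i) 2) => w fw.
    by have [] := bcoord w i fw.
  have c2 (i : 'I_n) : bounded_derivs (@frame R n) d m (fun w _ => w.2 0 i).
    apply: (@bounded_derivs_cst R _ frame d m (fun w => w.2 0 i) 2) => w fw.
    by have [] := bcoord w i fw.
  move=> fs; have IHi i := IHf _ (smooth_off0_partial i fs).
  by split; apply: bounded_derivs_sum => i; exact: bounded_derivsM.
have bslope : bounded_derivs frame d m radius_slope.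
  apply: bounded_derivsN; apply: bounded_derivsM; first exact: (bdir _ gsmooth).1.
  apply: (@bounded_derivsV _ _ _ _ _ _ (M + M)^-1); last exact: (bdir _ gsmooth).2.
    by rewrite invr_gt0 addr_gt0.
  by move=> w fw t td; exact: radial_derivative_ge.
split => [f fs|].
  apply: bounded_derivsS; first exact: unif_bounded_boundary.
    by move=> w fw t td; exact: is_derive_boundary.
  have [b1 b2] := bdir _ fs.
  by apply: bounded_derivsD b1 _; exact: bounded_derivsM.
by apply: bounded_derivsS bslope => // w fw t td; exact: is_derive_radius.
Qed.

End smooth_radius.

(** * Polar coordinates with the shell in place of the sphere *)

Section polar_formula.
Context {R : realType}.
Local Open Scope ereal_scope.
Local Notation leb := (@lebesgue_measure R).

(** Cut off at 0 so that it is a nonnegative density on the whole line. *)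
Definition pos_inv (s : R) : R := if (0 < s)%R then s^-1%R else 0%R.

Lemma pos_inv_ge0 s : (0 <= pos_inv s)%R.
Proof. by rewrite /pos_inv; case: ifP => // s0; rewrite invr_ge0 ltW. Qed.

Lemma measurable_pos_inv : measurable_fun setT pos_inv.
Proof.
rewrite (_ : pos_inv = (fun s : R => s^-1)%R \_ `]0%R, +oo[).
  apply/(measurable_restrictT _ _).1 => //.
  apply: subspace_continuous_measurable_fun => //.
  apply: continuous_in_subspaceT => x; rewrite inE/= in_itv/= andbT => x0.
  by apply: inv_continuous; rewrite gt_eqF.
apply/funext => s; rewrite patchE /pos_inv; congr (if _ then _ else _).
by apply/idP/idP; rewrite inE/= in_itv/= andbT.
Qed.

(* Density, with respect to the Lebesgue measure, of the dilation invariant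
   measure dr/r on the r > 0 such that r < a <= 2 r. *)
Definition dyadic_density (a r : R) : R :=
  (pos_inv r * \1_[set r : R | (r ^+ 2 < a ^+ 2)%R /\ (a ^+ 2 <= 4 * r ^+ 2)%R] r)%R.

Definition dyadic_mass : \bar R := \int[leb]_r (dyadic_density 1 r)%:E.

Lemma measurable_dyadic_set a :
  measurable [set r : R | (r ^+ 2 < a ^+ 2)%R /\ (a ^+ 2 <= 4 * r ^+ 2)%R].
Proof.
apply: measurableI.
  rewrite [X in measurable X](_ : _ = ~` [set r : R | (a ^+ 2 <= r ^+ 2)%R]).
    by apply: measurableC; apply: measurable_ge_fun; exact: exprn_measurable.
  by apply/seteqP; split => r /=; rewrite ltNge => /negP.
apply: measurable_ge_fun; apply: measurable_funM; first exact: measurable_cst.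
exact: exprn_measurable.
Qed.

Lemma measurable_dyadic_density a : measurable_fun setT (dyadic_density a).
Proof.
apply: measurable_funM; first exact: measurable_pos_inv.
by apply: measurable_indic; exact: measurable_dyadic_set.
Qed.

Lemma dyadic_density_ge0 a r : (0 <= dyadic_density a r)%R.
Proof. by rewrite mulr_ge0 ?pos_inv_ge0// indicE. Qed.

(** Dilation invariance of dr/r: under the substitution by [a], the Jacobian cancels against the
    inverse. *)
Lemma integral_dyadic_density (a : R) : (0 < a)%R ->
  \int[leb]_r (dyadic_density a r)%:E = dyadic_mass.
Proof.
move=> a0; rewrite -(@ge0_integral_affine _ a 0 (fun r => (dyadic_density a r)%:E))//.
- rewrite -ge0_integralZl//; last 3 first.
  + apply/measurable_EFinP/(measurableT_comp (measurable_dyadic_density a)).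
    by apply: measurable_funD => //; exact: mulrl_measurable.
  + by move=> r _; rewrite lee_fin dyadic_density_ge0.
  + by rewrite lee_fin ltW.
  apply: eq_integral => r _; rewrite addr0 -EFinM; congr EFin.
  rewrite /dyadic_density mulrA; congr (_ * _)%R.
    rewrite /pos_inv pmulr_rgt0//; case: ifP => r0; last by rewrite mulr0.
    by rewrite invfM mulrA mulfV ?mul1r// gt_eqF.
  have e1 : ((a * r) ^+ 2 < a ^+ 2)%R = (r ^+ 2 < 1 ^+ 2)%R.
    by rewrite exprMn expr1n gtr_pMr ?exprn_gt0.
  have e2 : (a ^+ 2 <= 4 * (a * r) ^+ 2)%R = (1 ^+ 2 <= 4 * r ^+ 2)%R.
    by rewrite exprMn expr1n mulrCA ler_pMr ?exprn_gt0.
  rewrite !indicE; congr (nat_of_bool _)%:R; apply/idP/idP; rewrite !inE/=.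
    by rewrite e1 e2.
  by rewrite e1 e2.
- by apply/measurable_EFinP; exact: measurable_dyadic_density.
- by move=> r; rewrite lee_fin dyadic_density_ge0.
Qed.

(** The mass is log 2; this bound and the next one compare 1/r with constants on [1/2, 1). *)
Lemma dyadic_mass_gt0 : 0 < dyadic_mass.
Proof.
apply: (@lt_le_trans _ _ (\int[leb]_r (\1_(`[2^-1%R, 1%R[ : set R) r)%:E)).
  rewrite integral_indic// setIT -[X in _ < X]/(lebesgue_measure `[2^-1%R, 1%R[%classic).
  rewrite lebesgue_measure_itv/= lte_fin invf_lt1// ltr1n -EFinB lte_fin subr_gt0.
  by rewrite invf_lt1// ltr1n.
apply: ge0_le_integral => //.
- by apply/measurable_EFinP; exact: measurable_indic.
- by apply/measurable_EFinP; exact: measurable_dyadic_density.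
move=> r _; rewrite lee_fin indicE; have [|_] := boolP (r \in _); last exact: dyadic_density_ge0.
rewrite inE/= in_itv/= => /andP[r1 r2].
have r0 : (0 < r)%R by rewrite (lt_le_trans _ r1).
have r2' : (1 <= 2 * r)%R by rewrite mulrC -ler_pdivrMr// mul1r.
rewrite /dyadic_density /pos_inv r0 indicE mem_set/=; last by split; nra.
by rewrite mulr1 invf_ge1// ltW.
Qed.

Lemma dyadic_mass_lty : dyadic_mass < +oo.
Proof.
apply: (@le_lt_trans _ _ (\int[leb]_r (2 * \1_(`[2^-1%R, 1%R[ : set R) r)%:E)).
  apply: ge0_le_integral => //.
  - by move=> r _; rewrite lee_fin dyadic_density_ge0.
  - by apply/measurable_EFinP; exact: measurable_dyadic_density.
  - apply/measurable_EFinP/measurable_funM; first exact: measurable_cst.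
    exact: measurable_indic.
  move=> r _; rewrite lee_fin /dyadic_density /pos_inv.
  case: ifP => r0; last by rewrite mul0r mulr_ge0// indicE.
  rewrite [X in (_ * X <= _)%R]indicE.
  have [|_] := boolP (r \in _); last by rewrite mulr0 mulr_ge0// indicE.
  rewrite inE/= expr1n => -[r1 r2].
  have r12 : (2^-1 <= r)%R by rewrite -[(2^-1)%R]mul1r ler_pdivrMr//; nra.
  have r1' : (r < 1)%R by nra.
  rewrite indicE mem_set/= ?in_itv/= ?r12//.
  by rewrite !mulr1 -[leRHS]invrK lef_pV2// posrE.
under eq_integral do rewrite EFinM.
rewrite ge0_integralZl//; last by apply/measurable_EFinP; exact: measurable_indic.
rewrite integral_indic// setIT -[X in _ * X]/(lebesgue_measure `[2^-1%R, 1%R[%classic).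
by rewrite lebesgue_measure_itv/=; case: ifP => _; rewrite -?EFinB -?EFinM ?ltry ?mule0.
Qed.

Section star_shaped.
Variables (m : nat) (S : set 'rV[R]_m.+1) (rho : 'rV[R]_m.+1 -> R).
Hypotheses (mS : measurable S)
  (rho_gt0 : forall y, shell m.+1 y -> (0 < rho y)%R)
  (S_ray : forall y, shell m.+1 y -> forall r : R, (0 < r)%R ->
    S (r *: y) <-> (r <= rho y)%R).

Let posX (r : R) : R := if (0 < r)%R then (r ^+ m)%R else 0%R.

Let posX_ge0 r : (0 <= posX r)%R.
Proof. by rewrite /posX; case: ifP => // r0; rewrite exprn_ge0// ltW. Qed.

Let measurable_posX : measurable_fun setT posX.
Proof.
rewrite (_ : posX = (fun s : R => s ^+ m)%R \_ `]0%R, +oo[).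
  by apply/(measurable_restrictT _ _).1 => //; exact: exprn_measurable.
apply/funext => s; rewrite patchE /posX; congr (if _ then _ else _).
by apply/idP/idP; rewrite inE/= in_itv/= andbT.
Qed.

Let W := [set p : measurableTypeR R * 'rV[R]_m.+1 | shell m.+1 p.2 /\ S (p.1 *: p.2)].

Let mscale_pair : measurable_fun setT
  (fun p : measurableTypeR R * 'rV[R]_m.+1 => p.1 *: p.2).
Proof.
apply: measurable_to_row => i; under [X in measurable_fun _ X]funext do rewrite mxE.
apply: measurable_funM; first exact: measurable_fst.
exact: (measurableT_comp (measurable_coord i) measurable_snd).
Qed.

Let mW : measurable W.
Proof.
apply: measurableI.
  exact: (measurable_preimage measurable_snd (@measurable_shell R m.+1)).
exact: (measurable_preimage mscale_pair mS).
Qed.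

Let F (p : measurableTypeR R * 'rV[R]_m.+1) : \bar R := (posX p.1 * \1_W p)%:E.

Let mF : measurable_fun setT F.
Proof.
apply/measurable_EFinP; apply: measurable_funM; last exact: measurable_indic.
exact: (measurableT_comp measurable_posX measurable_fst).
Qed.

Let F_ge0 p : 0 <= F p.
Proof. by rewrite lee_fin mulr_ge0// indicE. Qed.

Lemma integral_ray y : shell m.+1 y ->
  \int[leb]_r F (r, y) = (rho y ^+ m.+1 / m.+1%:R)%:E.
Proof.
move=> yE; have r0 := rho_gt0 yE.
transitivity (\int[leb]_(r in `]0%R, rho y]) (r ^+ m)%:E).
  rewrite [RHS]integral_mkcond; apply: eq_integral => r _.
  rewrite patchE /F /posX/=; have [r_gt0|r_le0] := ltP 0%R r; last first.
    rewrite mul0r; case: ifP => //; rewrite inE/= in_itv/= => /andP[].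
    by rewrite ltNge r_le0.
  rewrite indicE; have [rW|rW] := boolP ((r, y) \in W).
    rewrite mulr1 mem_set//= in_itv/= r_gt0/=.
    by move: rW; rewrite inE => -[_]; exact: (S_ray yE r_gt0).1.
  rewrite mulr0; case: ifPn => //; rewrite inE/= in_itv/= => /andP[_ rr].
  by move/negP: rW => []; apply/mem_set; split => //; exact: (S_ray yE r_gt0).2.
rewrite integral_itv_obnd_cbnd//; last first.
  by apply/measurable_EFinP; apply: measurable_funTS; exact: exprn_measurable.
pose P : {poly R} := (m.+1%:R^-1 *: 'X^(m.+1))%R.
have PE : (P^`() = 'X^m)%R.
  by rewrite /P derivZ derivXn/= -scalerMnr scalerMnl -[X in X *: _]mulr_natr mulVf ?scale1r.
have := integral_deriv_poly P r0; rewrite PE.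
under eq_integral do rewrite hornerXn.
by move=> ->; rewrite /P !hornerZ !hornerXn expr0n mulr0 subr0 mulrC.
Qed.

(** Nothing is assumed on the measurability of [rho]; its power is a partial integral of the
    measurable [F], to which Tonelli applies. *)
Lemma measurable_radial_power :
  measurable_fun (shell m.+1) (fun y => rho y ^+ m.+1 / m.+1%:R)%R.
Proof.
apply/measurable_EFinP.
have mG := measurable_fun_fubini_tonelli_G (m1 := leb) F mF F_ge0.
apply: (eq_measurable_fun _ _ (measurable_funTS mG)) => y /set_mem yE.
by rewrite /fubini_G integral_ray.
Qed.

(** The condition 1 < |y| <= 2 after the substitution z = r y. *)
Let W' := [set p : measurableTypeR R * 'rV[R]_m.+1 |
  (p.1 ^+ 2 < dotv p.2 p.2)%R /\ (dotv p.2 p.2 <= 4 * p.1 ^+ 2)%R].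

Let mW' : measurable W'.
Proof.
have m1 : measurable_fun setT (fun p : measurableTypeR R * 'rV[R]_m.+1 => (p.1 ^+ 2)%R : R).
  by apply: measurable_funX; exact: measurable_fst.
have m2 : measurable_fun setT (fun p : measurableTypeR R * 'rV[R]_m.+1 => dotv p.2 p.2).
  by apply: measurable_dotv; exact: measurable_snd.
apply: measurableI.
  rewrite [X in measurable X](_ : _ = ~` [set p | 0 <= p.1 ^+ 2 - dotv p.2 p.2]%R).
    by apply: measurableC; apply: measurable_ge_fun; exact: measurable_funB.
  by apply/seteqP; split => p /=; rewrite subr_ge0 ltNge => /negP.
rewrite [X in measurable X](_ : _ = [set p | 0 <= 4 * p.1 ^+ 2 - dotv p.2 p.2]%R).
  apply: measurable_ge_fun; apply: measurable_funB => //.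
  by apply: measurable_funM => //; exact: measurable_cst.
by apply/seteqP; split => p /=; rewrite subr_ge0.
Qed.

Let G (p : measurableTypeR R * 'rV[R]_m.+1) : \bar R :=
  (pos_inv p.1 * \1_([set p | S p.2] `&` W') p)%:E.

Let mSW' : measurable ([set p : measurableTypeR R * 'rV[R]_m.+1 | S p.2] `&` W').
Proof. by apply: measurableI => //; exact: (measurable_preimage measurable_snd mS). Qed.

Let mG : measurable_fun setT G.
Proof.
apply/measurable_EFinP; apply: measurable_funM; last exact: measurable_indic.
exact: (measurableT_comp measurable_pos_inv measurable_fst).
Qed.

Let G_ge0 p : 0 <= G p.
Proof. by rewrite lee_fin mulr_ge0// ?pos_inv_ge0// indicE. Qed.

Let integral_indic_scale (c : R) (A : set 'rV[R]_m.+1) : (0 <= c)%R -> measurable A ->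
  \int[lebR m.+1]_y (c * \1_A y)%:E = c%:E * lebR m.+1 A.
Proof.
move=> c0 mA; under eq_integral do rewrite EFinM.
rewrite ge0_integralZl//; first by rewrite integral_indic// setIT.
by apply/measurable_EFinP; exact: measurable_indic.
Qed.

(** The substitution z = r y in dimension m+1 divides by r^(m+1), which turns the weight r^m into
    1/r. *)
Let slice_scaling r : \int[lebR m.+1]_y F (r, y) = \int[lebR m.+1]_z G (r, z).
Proof.
have mW'r : measurable [set z | S z /\ W' (r, z)].
  exact: (measurable_preimage (@pair1_measurable _ _ (measurableTypeR R) _ r) mSW').
have mWr : measurable [set y | W (r, y)].
  exact: (measurable_preimage (@pair1_measurable _ _ (measurableTypeR R) _ r) mW).
transitivity ((posX r)%:E * lebR m.+1 [set y | W (r, y)]).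
  by rewrite -integral_indic_scale.
transitivity ((pos_inv r)%:E * lebR m.+1 [set z | S z /\ W' (r, z)]); last first.
  by rewrite -integral_indic_scale ?pos_inv_ge0.
rewrite /posX /pos_inv; case: ifPn => r0; last by rewrite !mul0e.
rewrite -(lebR_affine 0 r0 mW'r) muleA -EFinM exprS mulKf ?gt_eqF//.
congr (_ * lebR _ _); apply/funext => y /=.
have e1 : (r ^+ 2 < dotv (r *: y + 0) (r *: y + 0))%R = (1 < dotv y y)%R.
  by rewrite addr0 dotvZl dotvZr mulrA -expr2 ltr_pMr ?exprn_gt0.
have e2 : (dotv (r *: y + 0) (r *: y + 0) <= 4 * r ^+ 2)%R = (dotv y y <= 2 ^+ 2)%R.
  rewrite addr0 dotvZl dotvZr mulrA -expr2 mulrC ler_pM2r ?exprn_gt0//.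
  by rewrite -natrX.
apply/propext; rewrite /W/W'/= e1 e2 addr0 /shell/ball2/= expr1n ltNge.
by split=> [[[? /negP ?] ?]|[? [/negP ? ?]]].
Qed.

Let measurable_origin : measurable [set (0%R : 'rV[R]_m.+1)].
Proof.
apply: closed_measurable_row; apply: accessible_closed_set1.
by apply: hausdorff_accessible; exact: norm_hausdorff.
Qed.

(** The origin is fixed by the dilation by 2, which multiplies measures by 2^(m+1) > 1. It must be
    discarded because no r satisfies the dyadic condition there. *)
Let lebR_origin : lebR m.+1 [set (0%R : 'rV[R]_m.+1)] = 0.
Proof.
have fin0 : lebR m.+1 [set (0%R : 'rV[R]_m.+1)] \is a fin_num.
  rewrite ge0_fin_numE//; apply: le_lt_trans (@lebR_ball2_lty R m.+1 1).
  apply: le_measure; rewrite ?inE//; first exact: measurable_ball2.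
  move=> x ->; rewrite /ball2/= (_ : dotv 0%R 0%R = 0%R) ?expr1n//.
  by apply/eqP; rewrite dotv_eq0.
have := @lebR_affine R m.+1 2 0 [set (0%R : 'rV[R]_m.+1)] (ltr0Sn R 1) measurable_origin.
rewrite (_ : [set x | _] = [set (0%R : 'rV[R]_m.+1)]); last first.
  apply/seteqP; split => x /=; rewrite addr0; last by move=> ->; rewrite scaler0.
  by move=> /eqP; rewrite scaler_eq0 pnatr_eq0/= => /eqP.
move: fin0; case: (lebR _ _) => // a _ [] /eqP.
rewrite -subr_eq0 -{2}[a]mul1r -mulrBl mulf_eq0 subr_eq0 => /orP[|/eqP ->//].
by rewrite gt_eqF// exprn_egt1// ltr1n.
Qed.

Let lebR_punctured : lebR m.+1 (S `\ 0%R) = lebR m.+1 S.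
Proof.
have m0 : measurable (S `\ (0%R : 'rV[R]_m.+1)) by exact: measurableD.
apply/eqP; rewrite eq_le; apply/andP; split.
  by apply: le_measure; rewrite ?inE//; exact: subIsetl.
apply: (@le_trans _ _ (lebR m.+1 ((S `\ 0%R) `|` [set (0%R : 'rV[R]_m.+1)]))).
  apply: le_measure; rewrite ?inE//; first exact: measurableU.
  by move=> x Sx; have [->|/eqP x0] := eqVneq x 0%R; [right|left].
by rewrite -[leRHS]adde0 -lebR_origin; exact: measureU2.
Qed.

(* Both sides integrate r^m dr dy over the pairs (r, y) with y in the shell and
   r *: y in S: first in y, after the substitution x = r *: y, then first in r. *)
Lemma polar_volume : dyadic_mass * lebR m.+1 S =
  \int[lebR m.+1]_(y in shell m.+1) (rho y ^+ m.+1 / m.+1%:R)%:E.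
Proof.
transitivity (\int[lebR m.+1]_y \int[leb]_r F (r, y)); last first.
  rewrite [RHS]integral_mkcond; apply: eq_integral => y _; rewrite patchE.
  case: ifPn => yE; first by rewrite integral_ray// -inE.
  apply: integral0_eq => r _; rewrite /F indicE memNset ?mulr0//= => -[yE' _].
  by move/negP: yE; apply; exact: mem_set.
rewrite -(fubini_tonelli F mF F_ge0).
under [RHS]eq_integral do rewrite slice_scaling.
rewrite (fubini_tonelli G mG G_ge0) -lebR_punctured.
have m0 : measurable (S `\ (0%R : 'rV[R]_m.+1)) by exact: measurableD.
transitivity (\int[lebR m.+1]_z (fine dyadic_mass * \1_(S `\ 0%R) z)%:E).
  by rewrite integral_indic_scale ?fineK ?ge0_fin_numE ?fine_ge0 ?ltW
    ?dyadic_mass_gt0 ?dyadic_mass_lty.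
apply: eq_integral => z _.
have GE r : G (r, z) = (\1_S z * dyadic_density (norm2 z) r)%:E.
  rewrite /G /dyadic_density mulrCA; congr (_ * _)%:E.
  rewrite !indicE -natrM mulnb; congr (nat_of_bool _)%:R.
  have n2 : (norm2 z ^+ 2 = dotv z z)%R by rewrite sqr_sqrtr// dotv_ge0.
  apply/idP/andP => [|[]]; rewrite !inE/= n2; first by case.
  by move=> ? [].
under [RHS]eq_integral do rewrite GE.
have [->|z0] := eqVneq z 0%R.
  rewrite indicE memNset ?mulr0; last by move=> -[_]; exact.
  apply/esym; apply: integral0_eq => r _; rewrite /dyadic_density.
  rewrite [X in (_ * (_ * X))%R]indicE memNset ?mulr0//=.
  rewrite /norm2 (_ : dotv 0%R 0%R = 0%R) ?sqrtr0 ?expr0n/=; last by apply/eqP; rewrite dotv_eq0.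
  by move=> -[]; rewrite ltNge sqr_ge0.
rewrite !indicE; have [zS|zS] := boolP (z \in S); last first.
  rewrite memNset ?mulr0; last by move=> [Sz _]; move/negP: zS; apply; exact: mem_set.
  by apply/esym; apply: integral0_eq => r _; rewrite mul0r.
rewrite mem_set ?mulr1; last by split; [exact/set_mem|exact/eqP].
under [RHS]eq_integral do rewrite mul1r.
by rewrite integral_dyadic_density ?norm2_gt0// fineK// ge0_fin_numE ?ltW
  ?dyadic_mass_gt0 ?dyadic_mass_lty.
Qed.

End star_shaped.
End polar_formula.

Lemma bounded_derivs_comp {R : realType} (T T' : Type) (D : set T) (D' : set T')
    (d : R) (phi : T' -> T) m (f : T -> R -> R) :
  (forall w, D' w -> D (phi w)) -> bounded_derivs D d m f ->
  bounded_derivs D' d m (fun w => f (phi w)).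
Proof.
move=> phiD; elim: m f => [|m IHm] f /= [[M fM] bf].
  by split => //; exists M => w /phiD; exact: fM.
split; first by exists M => w /phiD; exact: fM.
by split; [move=> w /phiD; exact: bf.1|exact: (IHm (fun w => derive1 (f w)) bf.2)].
Qed.

(** * The parallel section function in polar coordinates *)

Section sections_of_a_body.
Context {R : realType} (m : nat).
Let k := m.+1.
Variables (K : set 'rV[R]_k.+1) (r0 M : R).
Hypotheses (Kcompact : compact K)
  (Kconvex : forall x y a, K x -> K y -> 0 <= a -> a <= 1 -> K (a *: x + (1 - a) *: y))
  (r0_gt0 : 0 < r0) (ball_sub_K : forall x, dotv x x <= r0 ^+ 2 -> K x)
  (M_gt0 : 0 < M) (K_sub_ball : forall x, K x -> dotv x x <= M ^+ 2)
  (gsmooth : smooth_off0 (minkowski_functional K)).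

Let Kclosed : closed K.
Proof. by apply: compact_closed => //; exact: norm_hausdorff. Qed.

Let mK : measurable K. Proof. exact: closed_measurable_row. Qed.

Definition hyperplane_basis (xi : 'rV[R]_k.+1) : 'M[R]_(k, k.+1) :=
  xget 0 (orthonormal_complement xi).

Lemma hyperplane_basisP xi : unit_sphere xi ->
  orthonormal_complement xi (hyperplane_basis xi).
Proof. by move=> /orthonormal_complement_neq0 neq0; exact: xgetPex. Qed.

Definition slice xi t : set 'rV[R]_k := [set y | K (t *: xi + y *m hyperplane_basis xi)].

Lemma measurable_slice xi t : measurable (slice xi t).
Proof.
apply: (measurable_preimage (f := fun y => t *: xi + y *m hyperplane_basis xi)) => //.
apply: measurable_to_row => i; under [X in measurable_fun _ X]funext do rewrite mxE.
apply: measurable_funD; first exact: measurable_cst.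
exact: (measurableT_comp (measurable_coord i) (measurable_mulmx _)).
Qed.

Lemma slice_sub_ball xi t : unit_sphere xi -> slice xi t `<=` ball2 k M.
Proof.
move=> xi1 y /K_sub_ball; have [BB Bxi] := hyperplane_basisP xi1.
rewrite dotvDl !dotvDr !dotvZl !dotvZr xi1 (dotvC _ xi).
have -> : dotv xi (y *m hyperplane_basis xi) = 0.
  by rewrite dotvC dotvE -mulmxA Bxi mulmx0 mxE.
rewrite dotv_mulmx_orth// !mulr0 add0r addr0 mulr1 -expr2 /ball2/=.
by apply: le_trans; rewrite lerDr sqr_ge0.
Qed.

Lemma lebR_slice_fin xi t : unit_sphere xi -> lebR k (slice xi t) \is a fin_num.
Proof.
move=> xi1; rewrite ge0_fin_numE//; apply: le_lt_trans (@lebR_ball2_lty R k M).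
apply: le_measure; rewrite ?inE; [exact: measurable_slice|exact: measurable_ball2|].
exact: slice_sub_ball.
Qed.

(** Turns the image under coordinates into a preimage, whose measurability is clear: by [decomp], a
    point is recovered from its component along [xi] and its coordinates in the hyperplane. *)
Lemma parallel_sectionE xi t : unit_sphere xi ->
  parallel_section K xi t = fine (lebR k (slice xi t)).
Proof.
move=> xi1; rewrite /parallel_section /hyperplane_volume lebRE; congr (fine (lebR k _)).
have [BB Bxi] := hyperplane_basisP xi1; rewrite -/(hyperplane_basis xi).
set B := hyperplane_basis xi.
have xiB : xi *m B^T = 0 by rewrite -[LHS]trmxK trmx_mul trmxK Bxi trmx0.
have decomp : xi^T *m xi + B^T *m B = 1%:M.
  pose Q : 'M[R]_(1 + k, k.+1) := col_mx xi B.
  have QQ : Q *m Q^T = 1%:M.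
    rewrite /Q tr_col_mx mul_col_row BB Bxi xiB (scalar_mx_block 1).
    by congr block_mx; rewrite [LHS]mx11_scalar -dotvE xi1.
  by rewrite -(mulmx1C QQ) /Q tr_col_mx mul_row_col.
apply/seteqP; split => [_ [x [Kx xt] <-]|y Ky].
  rewrite /slice/= -/B (_ : t *: xi = x *m xi^T *m xi).
    by rewrite -!mulmxA -mulmxDr decomp mulmx1.
  by rewrite [x *m _]mx11_scalar -dotvE xt mul_scalar_mx.
exists (t *: xi + y *m B); last first.
  by rewrite mulmxDl -scalemxAl xiB scaler0 add0r -mulmxA BB mulmx1.
split => //=; rewrite dotvDl dotvZl xi1 mulr1 dotvE -mulmxA Bxi mulmx0 mxE.
by rewrite addr0.
Qed.

Local Notation d := (r0 / 2).
Local Notation frame_of xi y := (xi, y *m hyperplane_basis xi).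

(** The bounds 1 and 4 in [frame] are the squared radii of the shell. *)
Lemma frame_ofP xi y : unit_sphere xi -> shell k y -> frame (frame_of xi y).
Proof.
move=> xi1 [y2 y1]; have [BB Bxi] := hyperplane_basisP xi1; split => //=.
- by rewrite dotvC dotvE -mulmxA Bxi mulmx0 mxE.
- rewrite dotv_mulmx_orth// ltW// ltNge; apply/negP => H; apply: y1.
  by rewrite /ball2/= expr1n.
- by rewrite dotv_mulmx_orth// (le_trans y2)// -natrX.
Qed.

Let polar_integrand (xi : 'rV[R]_k.+1) (y : 'rV[R]_k) (t : R) : R :=
  radius K (frame_of xi y) t ^+ k / k%:R.

Let slice_ray xi t : unit_sphere xi -> `|t| < d -> forall y, shell k y ->
  forall r : R, 0 < r -> slice xi t (r *: y) <-> r <= radius K (frame_of xi y) t.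
Proof.
move=> xi1 td y yE r r_gt0; rewrite /slice/= -scalemxAl.
exact: (half_plane_point_in Kclosed Kconvex r0_gt0 ball_sub_K M_gt0 K_sub_ball
  (frame_ofP xi1 yE) td (ltW r_gt0)).
Qed.

Let slice_radius_gt0 xi t : unit_sphere xi -> `|t| < d -> forall y, shell k y ->
  0 < radius K (frame_of xi y) t.
Proof.
move=> xi1 td y yE.
exact: (radius_gt0 r0_gt0 ball_sub_K M_gt0 K_sub_ball
  (frame_ofP xi1 yE) td).
Qed.

Let mass := fine (@dyadic_mass R).

Let massE : mass%:E = @dyadic_mass R.
Proof. by rewrite fineK// ge0_fin_numE ?dyadic_mass_lty// ltW// dyadic_mass_gt0. Qed.

Let mass_gt0 : 0 < mass.
Proof. by rewrite -lte_fin massE dyadic_mass_gt0. Qed.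

Lemma parallel_section_polar xi t : unit_sphere xi -> `|t| < d ->
  parallel_section K xi t =
  mass^-1 * \int[lebR k]_(y in shell k) polar_integrand xi y t.
Proof.
move=> xi1 td; rewrite parallel_sectionE//.
have := polar_volume (measurable_slice xi t) (slice_radius_gt0 xi1 td) (slice_ray xi1 td).
rewrite -massE -(fineK (lebR_slice_fin t xi1)) -EFinM => E.
by rewrite /Rintegral -E/= mulKf// gt_eqF.
Qed.

(** The bounds on the radius are uniform over frames, hence over pairs of a direction and a shell
    point; the integral over the shell leaves them uniform in the direction. *)
Lemma bounded_derivs_parallel_section j :
  bounded_derivs unit_sphere d j (parallel_section K).
Proof.
have brad : bounded_derivs [set p : 'rV[R]_k.+1 * 'rV[R]_k | unit_sphere p.1 /\ shell k p.2] d j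
    (fun p => polar_integrand p.1 p.2).
  apply: bounded_derivsM; last first.
    by apply: (@bounded_derivs_cst _ _ _ _ _ (fun=> k%:R^-1) `|k%:R^-1|).
  apply: bounded_derivsX.
  have [_ brho] := bounded_derivs_boundary Kclosed Kconvex r0_gt0 ball_sub_K M_gt0 K_sub_ball
    gsmooth Kcompact j.
  apply: (bounded_derivs_comp (phi := fun p : 'rV[R]_k.+1 * 'rV[R]_k => frame_of p.1 p.2)) brho.
  by move=> p [p1 p2]; exact: frame_ofP.
have bint := bounded_derivs_Rintegral (@measurable_shell R k) (@lebR_shell_lty R k)
  (fun xi xi1 t td => measurable_radial_power (measurable_slice xi t)
    (slice_radius_gt0 xi1 td) (slice_ray xi1 td)) brad.
apply: (@bounded_derivs_ext _ _ _ _ _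
  (fun xi t => mass^-1 * \int[lebR k]_(y in shell k) polar_integrand xi y t)).
  by move=> xi xi1 t td; rewrite parallel_section_polar.
apply: bounded_derivsM bint.
exact: (@bounded_derivs_cst _ _ _ _ _ (fun=> mass^-1) `|mass^-1|).
Qed.

Lemma slab_volume_section xi s : unit_sphere xi -> 
  slab_volume K xi s = \int[lebesgue_measure]_(x in `[- s, s]) parallel_section K xi x.
Proof.
move=> xi1; have xiB := hyperplane_basisP xi1; have [BB Bxi] := xiB.
rewrite /slab_volume (lebR_slices xi1 xiB); last exact: measurable_slab.
congr fine; rewrite [RHS]integral_mkcond; apply: eq_integral => x _; rewrite patchE.
have dx (y : 'rV[R]_k) : dotv (x *: xi + y *m hyperplane_basis xi) xi = x.
  by rewrite dotvDl dotvZl xi1 mulr1 dotvE -mulmxA Bxi mulmx0 mxE addr0.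
case: ifPn => xs.
  have xs' : `|x| <= s by move: xs; rewrite inE/= in_itv/= -ler_norml.
  rewrite parallel_sectionE// fineK ?lebR_slice_fin//; congr (lebR k _).
  by apply/funext => y; apply/propext; rewrite /slab/slice/= dx; split=> [[]|].
rewrite (_ : [set y | _] = set0) ?measure0//; apply/seteqP; split => // y /=.
rewrite /slab/= dx => -[_ xs'].
by move/negP: xs; apply; apply/mem_set; rewrite /= in_itv/= -ler_norml.
Qed.

End sections_of_a_body.

(** * The vanishing derivative of order n - 1 *)

Section vanishing_derivative.
Context {R : realType} (h' : nat).
Let h := h'.+1.
Let k := h.*2.
Variables (K : set 'rV[R]_k.+1) (r0 M : R).
Hypotheses (Kcompact : compact K)
  (Kconvex : forall x y a, K x -> K y -> 0 <= a -> a <= 1 -> K (a *: x + (1 - a) *: y))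
  (r0_gt0 : 0 < r0) (ball_sub_K : forall x, dotv x x <= r0 ^+ 2 -> K x)
  (M_gt0 : 0 < M) (K_sub_ball : forall x, K x -> dotv x x <= M ^+ 2)
  (gsmooth : smooth_off0 (minkowski_functional K)).
Hypothesis top_derivative0 :
  forall xi, unit_sphere xi -> derive1n k (parallel_section K xi) 0 = 0.

Local Notation d := (r0 / 2).

Let bA j : bounded_derivs unit_sphere d j (parallel_section K) :=
  bounded_derivs_parallel_section Kcompact Kconvex r0_gt0 ball_sub_K M_gt0 K_sub_ball gsmooth j.

(** The Taylor polynomial contributes nothing, its coefficient of order k = n - 1 being 0. The
    remainder is O(|x|^(k+1)), and integration over [-s, s] gains one more power. *)
Lemma dilation_comb_section_le : exists2 C, 0 <= C &
  forall xi, unit_sphere xi -> forall t, 0 < t -> 2 ^+ h * t < d ->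
  `|dilation_comb h (fun s => slab_volume K xi s) t| <= C * t ^+ k.+2.
Proof.
have d0 : 0 < d by rewrite divr_gt0.
have [N HN] := bounded_derivs_taylor d0 (bA k.+1).
pose C0 : R := \sum_(i < h.+1) `|(dilation_poly h)`_i| * (2 ^+ h) ^+ k.+2.
have C00 : 0 <= C0 by apply: sumr_ge0 => i _; rewrite mulr_ge0// exprn_ge0// exprn_ge0.
(* 2 |N| bounds the integral of the remainder over an interval of length 2 s; [C0] is the cost of
   the dilations. *)
exists (C0 * (2 * `|N|)); first by rewrite !mulr_ge0.
move=> xi xi1 t t0 td; have [p [sp pj pA]] := HN _ xi1.
have pk0 : p`_k = 0.
  have := pj k (ltnSn k); rewrite top_derivative0// => /eqP.
  by rewrite mulf_eq0 pnatr_eq0 -leqn0 leqNgt fact_gt0 orbF => /eqP.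
have ip s : (@lebesgue_measure R).-integrable `[- s, s] (EFin \o (fun x => p.[x])).
  apply: continuous_compact_integrable; first exact: segment_compact.
  by apply: continuous_subspaceT; exact: continuous_horner.
have iA s : s < d -> (@lebesgue_measure R).-integrable `[- s, s] (EFin \o parallel_section K xi).
  move=> sd; apply: continuous_compact_integrable; first exact: segment_compact.
  apply: derivable_within_continuous => x; rewrite in_itv/= -ler_norml => xs.
  by have [_ [dA _]] := bA 1; apply: dA => //; exact: le_lt_trans sd.
rewrite (@eq_dilation_comb _ _ _ (fun s =>
    \int[lebesgue_measure]_(x in `[- s, s]) p.[x] +
    \int[lebesgue_measure]_(x in `[- s, s]) (parallel_section K xi x - p.[x]))); last first.
  move=> i ih; rewrite (slab_volume_section Kcompact K_sub_ball)// -RintegralD//.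
  - by apply: eq_Rintegral => x _; rewrite addrC subrK.
  - rewrite (_ : _ \o _ = (EFin \o parallel_section K xi) \- (EFin \o (fun x => p.[x])))%E//.
    apply: integrableB => //; apply: iA; apply: le_lt_trans td.
    by rewrite ler_pM2r// ler_weXn2l ?ler1n.
rewrite dilation_combD dilation_comb_integral_poly// pk0 mulr0 !mul0r add0r.
apply: dilation_comb_le => // s s0 sd.
have std : s < d by exact: le_lt_trans td.
have iAp : (@lebesgue_measure R).-integrable `[- s, s]
    (EFin \o (fun x => parallel_section K xi x - p.[x])).
  rewrite (_ : _ \o _ = (EFin \o parallel_section K xi) \- (EFin \o (fun x => p.[x])))%E//.
  by apply: integrableB => //; exact: iA.
apply: le_trans (le_normr_Rintegral _ iAp) _ => //.
apply: (@le_trans _ _ (\int[lebesgue_measure]_(x in `[- s, s]) (`|N| * s ^+ k.+1))).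
  apply: le_Rintegral => //.
  - have := integrable_norm iAp; by under eq_fun do rewrite /=.
  - apply: (@bounded_integrable _ _ _ _ _ (fun=> `|N| * s ^+ k.+1) `| `|N| * s ^+ k.+1|) => //.
    by rewrite /= lebesgue_measure_itv/=; case: ifP => _; rewrite -?EFinB ltry.
  move=> x /=; rewrite in_itv/= -ler_norml => xs.
  apply: le_trans (pA _ (le_lt_trans xs std)) _.
  apply: (@le_trans _ _ (`|N| * `|x| ^+ k.+1)); first by rewrite ler_wpM2r ?exprn_ge0// ler_norm.
  by rewrite ler_wpM2l// lerXn2r ?nnegrE// ltW.
rewrite Rintegral_cst//= lebesgue_measure_itv/= lte_fin gtrN// -EFinB/= opprK.
rewrite le_eqVlt; apply/orP; left; apply/eqP.
by rewrite [in RHS]exprSr; ring.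
Qed.

(** The estimate passes from unit directions to the shell by scaling: |xi| >= 1 there, so t / |xi|
    <= t. *)
Lemma vanishing_top_derivative_absurd : False.
Proof.
have [C C0 HC] := dilation_comb_section_le.
have mK : measurable K.
  by apply: closed_measurable_row; apply: compact_closed => //; exact: norm_hausdorff.
have Koo : (lebR k.+1 K < +oo)%E.
  apply: le_lt_trans (@lebR_ball2_lty R k.+1 M); apply: le_measure; rewrite ?inE//.
  exact: measurable_ball2.
have h0 : 0 < (2 : R) ^+ h by rewrite exprn_gt0.
have dh : 0 < d / 2 ^+ h by rewrite !divr_gt0.
apply: (slab_average_contradiction mK Koo r0_gt0 _ dh) => // xi xiE t t0 td.
have [xi0 xi1 xi2] := shell_norm2 xiE.
have n0 : 0 < norm2 xi by rewrite norm2_gt0.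
have tn : t / norm2 xi <= t by rewrite ler_pdivrMr// ler_peMr// ltW.
have -> : dilation_comb h (fun s => slab_volume K xi s) t =
    dilation_comb h (fun s => slab_volume K ((norm2 xi)^-1 *: xi) (s / norm2 xi)) t.
  by apply: eq_dilation_comb => i _; rewrite /slab_volume slab_normalize.
rewrite (dilation_comb_scale h (fun s => slab_volume K ((norm2 xi)^-1 *: xi) s)).
apply: (@le_trans _ _ (C * (t / norm2 xi) ^+ k.+2)).
  apply: HC; [exact: unit_sphere_normalize|exact: divr_gt0|].
  rewrite mulrC; apply: (@le_lt_trans _ _ (t * 2 ^+ h)); first by rewrite ler_pM2r.
  by rewrite -ltr_pdivlMr.
by apply: ler_wpM2l => //; apply: lerXn2r => //; rewrite nnegrE ltW// divr_gt0.
Qed.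

End vanishing_derivative.

(** * Convex bodies, dimension 1, and the theorem *)

Section convex_bodies.
Context {R : realType} {n : nat}.
Implicit Types (K : set 'rV[R]_n).

Lemma convex_setP K : convex_set K ->
  forall x y a, K x -> K y -> 0 <= a -> a <= 1 -> K (a *: x + (1 - a) *: y).
Proof.
move=> Kcvx x y a Kx Ky a0 a1.
by have /set_mem := Kcvx x y (Itv01 a0 a1) (mem_set Kx) (mem_set Ky).
Qed.

Lemma interior0_ball2 K : K° 0 ->
  exists2 r : R, 0 < r & forall x, dotv x x <= r ^+ 2 -> K x.
Proof.
move=> /nbhs_ballP[e /= e0 eK]; exists (e / 2); first by rewrite divr_gt0.
move=> x xe; apply: eK; rewrite -ball_normE/= sub0r normrN norm_row_lt//.
apply/forallP => i; apply: (@le_lt_trans _ _ (e / 2)); last first.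
  by rewrite ltr_pdivrMr// ltr_pMr// ltr1n.
rewrite -(ler_pXn2r (n := 2)) ?nnegrE ?divr_ge0 ?(ltW e0)// real_normK ?num_real//.
exact: le_trans (coord_sqr_le_dotv _ _) xe.
Qed.

Lemma compact_sub_ball2 K : compact K ->
  exists2 r : R, 0 < r & forall x, K x -> dotv x x <= r ^+ 2.
Proof.
move=> /compact_bounded[B [_ HB]]; set b := `|B| + 1.
have b1 : 1 <= b by rewrite lerDr.
have bB : B < b by rewrite (le_lt_trans (ler_norm B))// ltrDl.
exists (n.+1%:R * b); first by rewrite mulr_gt0// (lt_le_trans ltr01).
move=> x /(HB b bB) xb; apply: (@le_trans _ _ (\sum_(i < n) b ^+ 2)).
  apply: ler_sum => i _; rewrite -expr2 -real_normK ?num_real// lerXn2r ?nnegrE//.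
    by rewrite (le_trans ler01).
  exact: le_trans (coord_le_norm _ _) xb.
rewrite sumr_const card_ord exprMn -[leLHS]mulr_natl ler_wpM2r ?sqr_ge0// -natrX ler_nat.
by rewrite expnS expn1 (leq_trans (leqnSn n))// leq_pmulr.
Qed.

End convex_bodies.

(** The hyperplane is a single point, and [lebR 0] is the unit mass there. *)
Lemma parallel_section_dim1 (R : realType) (K : set 'rV[R]_1) (xi : 'rV[R]_1) :
  K 0 -> parallel_section K xi 0 = 1.
Proof.
move=> K0; rewrite /parallel_section /hyperplane_volume lebRE lebR0 diracE mem_set//.
exists 0; last by rewrite mul0mx.
by split => //=; rewrite dotvE mul0mx mxE.
Qed.

Theorem proposition3p2 (R : realType) (n N : nat) (n_odd : odd n)
    (lt_N_n : (N < n)%N) :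
  ~ exists K : set 'rV[R]_n,
      [/\ convex_body K,
          K° 0,
          infinitely_smooth K
        & forall m : nat, ~~ odd m -> (N <= m)%N ->
          forall xi : 'rV[R]_n, unit_sphere xi ->
            derive1n m (parallel_section K xi) 0 = 0].
Proof.
have nE : n = n./2.*2.+1 by rewrite -[LHS]odd_double_half n_odd.
move: n_odd lt_N_n; rewrite {}nE; move: n./2 => h _ lt_N_n [K [[Kcompact Kcvx _] K0 Ksmooth Kder]].
case: h => [|h] in K lt_N_n Kcompact Kcvx K0 Ksmooth Kder *.
  have xi1 : unit_sphere (const_mx 1 : 'rV[R]_1).
    by rewrite /unit_sphere/= /dotv big_ord1 mxE mulr1.
  (* For n = 1 the condition N < 1 brings in order 0, where the section function itself would have
     to vanish. *)
  have := Kder 0%N isT lt_N_n _ xi1; rewrite derive1n0 parallel_section_dim1.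
    by move/eqP; rewrite oner_eq0.
  exact: interior_subset K0.
have [r0 r0_gt0 ball_sub_K] := interior0_ball2 K0.
have [M M_gt0 K_sub_ball] := compact_sub_ball2 Kcompact.
apply: (vanishing_top_derivative_absurd Kcompact (convex_setP Kcvx) r0_gt0 ball_sub_K
  M_gt0 K_sub_ball Ksmooth).
(* The order n - 1 is even because n is odd, and it is at least N because N < n. *)
by apply: Kder => //; rewrite odd_double.
Qed.
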